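(* Suppose that the Metropolis--Hastings kernel $\mathsf{P}_{\mathrm{MH}}$ has a right spectral gap $\epsilon_{\mathrm{MH}}>0$, and that the density $\widetilde q(w')$ of the proposed multiplicative noise does not depend on $\theta'$. Then for every $h_*\in L^2(\pi)$ (viewed as a function $(\theta,w)\mapsto h_*(\theta)$ on $\mathcal X\times\mathcal W$), the asymptotic variance under the pseudo-marginal kernel $\mathsf{P}_{\mathrm{pm}}$ satisfies $$\mathsf{Var}_{\mathsf{P}_{\mathrm{pm}}}(h_* )\le\left\{\frac{2R_S^{\widetilde q}}{\epsilon_{\mathrm{MH}}}-1\right\}\|h_*\|^2_{L^2(\pi)},$$ where $$R_S^{\widetilde q}:=\iint_{\mathcal W\times\mathcal W}\widetilde q(w)\,\widetilde q(w')\,w\,w'\,(w\vee w')\,\mathrm dw\,\mathrm dw'.$$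
   Context: Let $\pi$ be a probability density (with respect to Lebesgue measure) on $\mathcal X\subseteq\mathbb R^d$ and, for each $\theta\in\mathcal X$, let $q(\cdot|\theta)$ be a proposal density on $\mathcal X$. Put $r(\theta,\theta')=\frac{\pi(\theta')q(\theta|\theta')}{\pi(\theta)q(\theta'|\theta)}$. The kernel $\mathsf{P}_{\mathrm{MH}}$ on $\mathcal X$ is the Metropolis--Hastings kernel that, from $\theta$, proposes $\theta'\sim q(\cdot|\theta)$ and accepts with probability $1\wedge r(\theta,\theta')$ (otherwise it stays at $\theta$); it is reversible with respect to $\pi$. Let $\mathcal W\subseteq[0,\infty)$ and let $\widetilde q$ be a probability density on $\mathcal W$ with $\int_{\mathcal W}w\,\widetilde q(w)\,\mathrm dw=1$; set $\nu(w)=w\,\widetilde q(w)$, a probability density. The pseudo-marginal kernel $\mathsf{P}_{\mathrm{pm}}$ on $\mathcal X\times\mathcal W$, from $(\theta,w)$, proposes $(\theta',w')$ from the density $q(\theta'|\theta)\widetilde q(w')$ and accepts with probability $1\wedge\{r(\theta,\theta')w'/w\}$ (otherwise it stays at $(\theta,w)$); it is reversible with respect to the density $\pi(\theta)\nu(w)$. For a Markov kernel $Q$ with stationary distribution $\mu$ and $h\in L^2(\mu)$, the asymptotic variance is $\mathsf{Var}_Q(h)=\lim_{n\to\infty}n\,\mathsf{Var}\left[\frac1n\sum_{i=1}^n h(X_i)\right]\in[0,\infty]$, where $(X_i)$ is the Markov chain with kernel $Q$ and $X_1\sim\mu$. With $L_0^2(\mu)=\{f\in L^2(\mu):\int f\,\mathrm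 d\mu=0\}$ and Dirichlet form $\mathcal E_Q(f)=\frac12\iint\mu(\mathrm dx)Q(x,\mathrm dy)\{f(y)-f(x)\}^2$, the right spectral gap of $Q$ is $\epsilon_Q=\inf\{\mathcal E_Q(f):f\in L_0^2(\mu),\|f\|_{L^2(\mu)}=1\}$. ''Has a right spectral gap'' means that this quantity is strictly positive. The notation is $a\wedge b=\min(a,b)$, $a\vee b=\max(a,b)$. *)

(* Defs.v *)
From HB Require Import structures.
From mathcomp Require Import all_boot all_order all_algebra.
From mathcomp Require Import all_classical all_reals all_analysis.
From mathcomp Require Import measurable_realfun.

Set Implicit Arguments.
Unset Strict Implicit.
Unset Printing Implicit Defensive.
Import Order.TTheory GRing.Theory Num.Theory.
Import numFieldNormedType.Exports.

Local Open Scope classical_set_scope.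
Local Open Scope ring_scope.
Local Open Scope ereal_scope.

(* [m1 \x m2] with its sigma-finiteness: the library's own instance is shadowed
   by the one for subprobabilities. *)
Section sigma_finite_prod.
Context d1 d2 (T1 : measurableType d1) (T2 : measurableType d2) (R : realType).
Variable m1 : {sigma_finite_measure set T1 -> \bar R}.
Variable m2 : {sigma_finite_measure set T2 -> \bar R}.

Definition sigma_finite_prod : set (T1 * T2) -> \bar R := m1 \x m2.

HB.instance Definition _ := Measure.on sigma_finite_prod.

Let sigma_finite_prodT : sigma_finite setT sigma_finite_prod.
Proof.
have /sigma_finiteP[F [TF ndF Foo]] := sigma_finiteT m1.
have /sigma_finiteP[G [TG ndG Goo]] := sigma_finiteT m2.
exists (fun n => F n `*` G n).
  rewrite -setXTT TF TG predeqE => -[x y]; split.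
    move=> [/= [n _ Fnx] [k _ Gky]]; exists (maxn n k) => //; split.
    - by move: x Fnx; exact/subsetPset/ndF/leq_maxl.
    - by move: y Gky; exact/subsetPset/ndG/leq_maxr.
  by move=> [n _ []/= ? ?]; split; exists n.
move=> k; have [? ?] := Foo k; have [? ?] := Goo k.
split; first exact: measurableX.
by rewrite /sigma_finite_prod product_measure1E// lte_mul_pinfty// ge0_fin_numE.
Qed.

HB.instance Definition _ := Measure_isSigmaFinite.Build _ _ _ sigma_finite_prod
  sigma_finite_prodT.

End sigma_finite_prod.

(* R^n is [n.-tuple R] with the product (= Borel) sigma-algebra. *)
Section lebesgue_tuple.
Context (R : realType).
Local Notation RR := (measurableTypeR R).

Definition cons_pair n (p : (RR * n.-tuple RR)%type) : n.+1.-tuple RR :=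
  [tuple of p.1 :: p.2].

Lemma measurable_cons_pair n : measurable_fun setT (@cons_pair n).
Proof.
exact: (measurable_cons (@measurable_fst _ _ RR (n.-tuple RR))
                        (@measurable_snd _ _ RR (n.-tuple RR))).
Qed.

Definition uncons_pair n (t : n.+1.-tuple RR) : RR * n.-tuple RR :=
  (thead t, [tuple of behead t]).

Lemma measurable_uncons_pair n : measurable_fun setT (@uncons_pair n).
Proof.
apply: measurable_fun_pair; first exact: measurable_tnth.
exact: measurable_behead.
Qed.

Section step.
Variables (n : nat) (mu : {sigma_finite_measure set (n.-tuple RR) -> \bar R}).

Definition lebesgue_cons (A : set (n.+1.-tuple RR)) : \bar R :=
  sigma_finite_prod (@lebesgue_measure R) mu (@cons_pair n @^-1` A).

Let mpre A : measurable A -> measurable (@cons_pair n @^-1` A).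
Proof.
by move=> mA; rewrite -[X in measurable X]setTI; exact: measurable_cons_pair.
Qed.

Let lebesgue_cons0 : lebesgue_cons set0 = 0.
Proof. by rewrite /lebesgue_cons preimage_set0 measure0. Qed.

Let lebesgue_cons_ge0 A : 0 <= lebesgue_cons A.
Proof. exact: measure_ge0. Qed.

Let lebesgue_cons_sigma_additive : semi_sigma_additive lebesgue_cons.
Proof.
move=> F mF tF mUF; rewrite /lebesgue_cons preimage_bigcup.
apply: measure_semi_sigma_additive.
- by move=> k; exact: mpre.
- apply/trivIsetP => /= i j _ _ ij; rewrite -preimage_setI.
  by move/trivIsetP : tF => /(_ _ _ _ _ ij) ->//; rewrite preimage_set0.
- by rewrite -preimage_bigcup; exact: mpre.
Qed.

HB.instance Definition _ := isMeasure.Build _ _ _ lebesgue_cons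
  lebesgue_cons0 lebesgue_cons_ge0 lebesgue_cons_sigma_additive.

Let lebesgue_cons_sigma_finite : sigma_finite setT lebesgue_cons.
Proof.
have [F FT mF] := sigma_finiteT
  [the {sigma_finite_measure set _ -> \bar R} of sigma_finite_prod (@lebesgue_measure R) mu].
exists (fun i => @uncons_pair n @^-1` F i).
  by rewrite -preimage_bigcup -FT preimage_setT.
move=> i; have [mFi Fi] := mF i; split.
  by rewrite -[X in measurable X]setTI; exact: measurable_uncons_pair.
rewrite /lebesgue_cons -comp_preimage.
rewrite (_ : _ \o _ = id) ?preimage_id//.
apply/funext => -[x t] /=; rewrite /uncons_pair /cons_pair/= theadE.
by congr pair; exact/val_inj.
Qed.

HB.instance Definition _ :=
  Measure_isSigmaFinite.Build _ _ _ lebesgue_cons lebesgue_cons_sigma_finite.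

End step.

(* Lebesgue measure on R^n, as the n-fold product. *)
Fixpoint lebesgue_tuple n : {sigma_finite_measure set (n.-tuple RR) -> \bar R} :=
  match n with
  | 0 => [the {sigma_finite_measure set _ -> \bar R} of \d_([tuple] : 0.-tuple RR)]
  | n'.+1 => [the {sigma_finite_measure set _ -> \bar R} of
               lebesgue_cons (lebesgue_tuple n')]
  end.

End lebesgue_tuple.

Lemma measurable_inv (R : realType) :
  measurable_fun setT (fun x : measurableTypeR R => x^-1%R : measurableTypeR R).
Proof.
rewrite -(setUv [set 0%R]); apply/measurable_funU => //.
  exact: measurableC.
split; first exact: measurable_fun_set1.
apply: open_continuous_measurable_fun.
  by apply: closed_openC; exact: closed_eq.
move=> x /set_mem /= x0; apply: inv_continuous; exact/eqP.
Qed.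

Section densities.
Context d (T : measurableType d) (R : realType).

Record density (m : {measure set T -> \bar R}) (S : set T) := Density {
  density_fun :> T -> R;
  density_measurable : measurable_fun S density_fun;
  density_ge0 : forall x, S x -> (0 <= density_fun x)%R;
  density_int : \int[m]_(x in S) (density_fun x)%:E = 1 }.

(* [q x y] is the density at y of the proposal made from x *)
Record proposal (m : {measure set T -> \bar R}) (S : set T) := Proposal {
  proposal_fun :> T -> T -> R;
  proposal_measurable :
    measurable_fun (S `*` S) (fun z : T * T => proposal_fun z.1 z.2);
  proposal_ge0 : forall x y, S x -> S y -> (0 <= proposal_fun x y)%R;
  proposal_int : forall x, S x -> \int[m]_(y in S) (proposal_fun x y)%:E = 1 }.

Section density_prob.
Variables (m : {measure set T -> \bar R}) (S : set T).

Definition density_prob (_ : measurable S) (f : density m S) : set T -> \bar R :=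
  fun A => \int[m]_(x in A `&` S) (f x)%:E.

Variables (mS : measurable S) (f : density m S).
Local Notation P := (density_prob mS f).

Let PE A : P A = \int[m]_(x in A) ((EFin \o f) \_ S) x.
Proof. by rewrite /density_prob integral_mkcondr. Qed.

Let patch_ge0 x : 0 <= ((EFin \o f) \_ S) x.
Proof.
by rewrite patchE; case: ifPn => // /set_mem Sx; rewrite lee_fin density_ge0.
Qed.

Let P0 : P set0 = 0.
Proof. by rewrite PE integral_set0. Qed.

Let P_ge0 A : 0 <= P A.
Proof. by rewrite PE; exact: integral_ge0. Qed.

Let P_sigma_additive : semi_sigma_additive P.
Proof.
rewrite (_ : P = fun A => \int[m]_(x in A) ((EFin \o f) \_ S) x); last first.
  by apply/funext => A; rewrite PE.
apply: semi_sigma_additive_nng_induced => //.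
apply/(measurable_restrictT _ _).1 => //; apply/measurable_EFinP.
exact: density_measurable.
Qed.

HB.instance Definition _ := isMeasure.Build _ _ _ P P0 P_ge0 P_sigma_additive.

Let P_setT : P setT = 1.
Proof. by rewrite /density_prob setTI density_int. Qed.

HB.instance Definition _ := Measure_isProbability.Build _ _ _ P P_setT.

End density_prob.

Section metropolis.
Variables (m : {sigma_finite_measure set T -> \bar R}) (S : set T).
Hypothesis mS : measurable S.
Variables (q : proposal m S) (rho : T -> T -> R).
Hypothesis mrho : measurable_fun (S `*` S) (fun z : T * T => rho z.1 z.2).
Hypothesis rho0 : forall x y, S x -> S y -> (0 <= rho x y)%R.

(* Subdensity at z.2 of an accepted move from z.1; cut off outside S * S, so that
   the kernel below is Markov on all of T and does not move from points outside S. *)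
Definition move_density (z : T * T) : R :=
  ((fun z : T * T => Num.min 1 (rho z.1 z.2) * q z.1 z.2) \_ (S `*` S))%R z.

Let move_ge0 z : (0 <= move_density z)%R.
Proof.
rewrite /move_density patchE; case: ifPn => // /set_mem [/= S1 S2].
by rewrite mulr_ge0 ?proposal_ge0// le_min ler01 rho0.
Qed.

Let measurable_move : measurable_fun setT move_density.
Proof.
apply/(measurable_restrictT _ _).1; first exact: measurableX.
apply: measurable_funM; last exact: proposal_measurable.
exact: measurable_minr.
Qed.

Let measurable_moveE : measurable_fun setT (EFin \o move_density).
Proof. exact/measurable_EFinP. Qed.

Let measurable_move1 x : measurable_fun setT (fun y => (move_density (x, y))%:E).
Proof. exact: (measurableT_comp measurable_moveE (pair1_measurable x)). Qed.

Let move_le1 x : \int[m]_y (move_density (x, y))%:E <= 1.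
Proof.
have [Sx|Sx] := pselect (S x); last first.
  rewrite integral0_eq// => y _; rewrite /move_density patchE ifN//.
  by apply/negP => /set_mem [].
rewrite -(proposal_int q Sx) integral_mkcond.
apply: ge0_le_integral => //.
- by move=> y _; rewrite lee_fin.
- apply/(measurable_restrictT _ _).1 => //; apply/measurable_EFinP.
  rewrite (_ : q x = (fun z => q z.1 z.2) \o (pair x))//.
  apply: (@measurable_comp _ _ _ _ _ _ (S `*` S)) => //.
  + exact: measurableX.
  + by move=> _ [y Sy <-]; split.
  + exact: proposal_measurable.
  + exact/measurable_funTS/pair1_measurable.
- move=> y _; rewrite /move_density !patchE.
  have [/set_mem[/= _ Sy]|/negP nS] := boolP (_ \in S `*` S).
    rewrite mem_set// lee_fin ler_piMl ?proposal_ge0//.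
    by rewrite ge_min lexx.
  rewrite ifN//; apply/negP => /set_mem Sy; apply: nS; exact/mem_set.
Qed.

Let move_ge0I x A : 0 <= \int[m]_(y in A) (move_density (x, y))%:E.
Proof. by apply: integral_ge0 => y _; rewrite lee_fin. Qed.

Let move_fin x : \int[m]_y (move_density (x, y))%:E \is a fin_num.
Proof. by rewrite ge0_fin_numE// (le_lt_trans (move_le1 x))// ltry. Qed.

Let stay_ge0 x : 0 <= 1 - \int[m]_y (move_density (x, y))%:E.
Proof. by rewrite sube_ge0 ?move_le1 ?move_fin//. Qed.

Definition metropolis_set (_ : measurable S)
    (_ : measurable_fun (S `*` S) (fun z : T * T => rho z.1 z.2))
    (_ : forall x y, S x -> S y -> (0 <= rho x y)%R) : T -> set T -> \bar R :=
  fun x A => \int[m]_(y in A) (move_density (x, y))%:E +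
    (1 - \int[m]_y (move_density (x, y))%:E) * \d_x A.

Local Notation M := (metropolis_set mS mrho rho0).

Section measure.
Variable x : T.

Let M0 : M x set0 = 0.
Proof. by rewrite /metropolis_set integral_set0 measure0 mule0 adde0. Qed.

Let M_ge0 A : 0 <= M x A.
Proof. by rewrite adde_ge0// mule_ge0. Qed.

Let M_sigma_additive : semi_sigma_additive (M x).
Proof.
move=> F mF tF mUF; rewrite /metropolis_set.
under eq_fun do rewrite big_split/= -ge0_sume_distrr//.
apply: cvgeD.
- by rewrite ge0_adde_def// inE ?mule_ge0.
- by apply: semi_sigma_additive_nng_induced => // y; rewrite lee_fin.
- apply: cvgeZl; first by rewrite fin_numB move_fin.
  exact: (@measure_semi_sigma_additive _ _ _ [the measure T R of \d_x]).
Qed.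

HB.instance Definition _ :=
  isMeasure.Build _ _ _ (M x) M0 M_ge0 M_sigma_additive.

End measure.

Definition metropolis : T -> {measure set T -> \bar R} := M.

Let measurable_metropolis U :
  measurable U -> measurable_fun setT (metropolis ^~ U).
Proof.
move=> mU; rewrite /metropolis /= /metropolis_set.
have mI V : measurable V ->
    measurable_fun setT (fun x => \int[m]_(y in V) (move_density (x, y))%:E).
  move=> mV.
  pose g (z : T * T) := ((EFin \o move_density) \_ (setT `*` V)) z.
  rewrite (_ : (fun x => _) = fun x => \int[m]_y g (x, y)); last first.
    apply/funext => x; rewrite integral_mkcond; apply: eq_integral => y _.
    by rewrite /g !patchE in_setX in_setT.
  apply: (@measurable_fun_fubini_tonelli_F _ _ _ _ _ m g).
    apply/(measurable_restrictT _ _).1; first exact: measurableX.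
    exact: measurable_funTS.
  by move=> z; rewrite /g patchE; case: ifPn => // _; rewrite lee_fin.
apply: emeasurable_funD; first exact: mI.
apply: emeasurable_funM; first by apply: emeasurable_funB => //; exact: mI.
exact: measurable_fun_dirac.
Qed.

HB.instance Definition _ := isKernel.Build _ _ _ _ _ metropolis
  measurable_metropolis.

Let metropolis_setT x : metropolis x setT = 1.
Proof.
by rewrite /metropolis/= /metropolis_set diracT mule1 addeC subeK.
Qed.

HB.instance Definition _ := Kernel_isProbability.Build _ _ _ _ _ metropolis
  metropolis_setT.

Definition metropolis_kernel : R.-pker T ~> T := metropolis.

End metropolis.
End densities.

Section markov.
Context d (T : measurableType d) (R : realType).

Section spectral_gap.
Variables (mu : probability T R) (Q : R.-pker T ~> T).

Definition dirichlet (f : T -> R) : \bar R :=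
  2^-1%:E * \int[mu]_x \int[Q x]_y ((f y - f x) ^+ 2)%:E.

Definition right_spectral_gap : \bar R :=
  ereal_inf [set dirichlet f | f in
    [set f : T -> R | [/\ f \in Lfun mu 2%:E, \int[mu]_x (f x)%:E = 0
      & 'N[mu]_2%:E [EFin \o f] = 1]]].

End spectral_gap.

Section chain.
Context d' (Omega : measurableType d') (P : probability Omega R).
Variable X : nat -> {RV P >-> T}.

(* the sigma-algebra generated by X 0, ..., X n *)
Definition past n : set (set Omega) :=
  <<s [set E | exists2 i, (i <= n)%N &
                 exists2 A, measurable A & E = X i @^-1` A] >>.

Definition markov_chain (mu : probability T R) (Q : R.-pker T ~> T) :=
  (forall A, measurable A -> P (X 0%N @^-1` A) = mu A) /\
  (forall n E A, past n E -> measurable A ->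
    P (E `&` X n.+1 @^-1` A) = \int[P]_(w in E) Q (X n w) A).

Definition scaled_variance (h : T -> R) (n : nat) : \bar R :=
  n%:R%:E * 'V_P[fun w => (n%:R^-1 * \sum_(i < n) h (X i w))%R].

Definition asymptotic_variance (h : T -> R) : \bar R :=
  limn (scaled_variance h).

End chain.
End markov.

Section pseudo_marginal.
Context (R : realType) (d : nat).
Local Notation RR := (measurableTypeR R).
Local Notation TT := (d.-tuple RR).
Local Notation lebd := (lebesgue_tuple R d).
Local Notation leb := (@lebesgue_measure R).
Local Notation lebdw := (sigma_finite_prod lebd leb).

Variables (X : set TT) (mX : measurable X).
Variables (pi : density lebd X) (q : proposal lebd X).

(* As x / 0 = 0, moves are rejected where the denominator vanishes, which
   is a null event for the chain in stationarity. *)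
Definition mh_ratio (x y : TT) : R := (pi y * q y x / (pi x * q x y))%R.

Lemma measurable_mh_ratio :
  measurable_fun (X `*` X) (fun z : TT * TT => mh_ratio z.1 z.2).
Proof.
have mXX : measurable (X `*` X) by exact: measurableX.
have mp1 : measurable_fun (X `*` X) (fun z : TT * TT => pi z.1).
  apply: (@measurable_comp _ _ _ _ _ _ X) => //.
  - by move=> _ [z [? ?] <-].
  - exact: density_measurable.
  - exact/measurable_funTS.
have mp2 : measurable_fun (X `*` X) (fun z : TT * TT => pi z.2).
  apply: (@measurable_comp _ _ _ _ _ _ X) => //.
  - by move=> _ [z [? ?] <-].
  - exact: density_measurable.
  - exact/measurable_funTS.
have mq := proposal_measurable q.
have mqs : measurable_fun (X `*` X) (fun z : TT * TT => q z.2 z.1).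
  rewrite (_ : (fun z => _) = (fun z : TT * TT => q z.1 z.2) \o
    (fun z : TT * TT => (z.2, z.1)))//.
  apply: (@measurable_comp _ _ _ _ _ _ (X `*` X)) => //.
  - by move=> _ [z [? ?] <-]; split.
  - exact/measurable_funTS/measurable_fun_pair.
apply: measurable_funM; first exact: measurable_funM.
apply: (measurableT_comp (@measurable_inv R)).
exact: measurable_funM.
Qed.

Lemma mh_ratio_ge0 x y : X x -> X y -> (0 <= mh_ratio x y)%R.
Proof.
by move=> Xx Xy; rewrite divr_ge0// mulr_ge0 ?density_ge0 ?proposal_ge0.
Qed.

Definition mh_target : probability TT R := density_prob mX pi.

Definition mh_kernel : R.-pker TT ~> TT :=
  metropolis_kernel mX q measurable_mh_ratio mh_ratio_ge0.

Variables (W : set RR) (mW : measurable W) (W0 : forall w : R, W w -> (0 <= w)%R).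
Variable qw : density leb W.

Definition R_S : \bar R :=
  \int[leb \x leb]_(z in W `*` W)
    (qw z.1 * qw z.2 * z.1 * z.2 * Num.max (z.1 : R) (z.2 : R))%:E.

Lemma measurable_XW : measurable (X `*` W).
Proof. exact: measurableX. Qed.

Lemma tonelliXW (f : TT -> R) (g : RR -> R) :
  measurable_fun X f -> (forall x, X x -> 0 <= f x)%R ->
  measurable_fun W g -> (forall w, W w -> 0 <= g w)%R ->
  \int[lebdw]_(z in X `*` W) (f z.1 * g z.2)%:E =
  \int[lebd]_(x in X) (f x)%:E * \int[leb]_(w in W) (g w)%:E.
Proof.
move=> mf f0 mg g0.
pose F := (EFin \o f) \_ X; pose G := (EFin \o g) \_ W.
have mF : measurable_fun setT F.
  by apply/(measurable_restrictT _ _).1 => //; exact/measurable_EFinP.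
have mG : measurable_fun setT G.
  by apply/(measurable_restrictT _ _).1 => //; exact/measurable_EFinP.
have F0 x : 0 <= F x.
  by rewrite /F patchE; case: ifPn => // /set_mem Xx; rewrite lee_fin f0.
have G0 w : 0 <= G w.
  by rewrite /G patchE; case: ifPn => // /set_mem Ww; rewrite lee_fin g0.
rewrite [LHS]integral_mkcond [X in X * _]integral_mkcond [X in _ * X]integral_mkcond.
rewrite -/F -/G.
transitivity (\int[lebd \x leb]_z (F z.1 * G z.2)).
  apply: eq_integral => z _; rewrite /F /G !patchE in_setX.
  have pt : point = 0 :> \bar R by [].
  by case: (z.1 \in X); case: (z.2 \in W); rewrite /= ?pt ?mule0 ?mul0e.
rewrite fubini_tonelli1; last 2 first.
- apply: emeasurable_funM; exact: measurableT_comp.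
- by move=> z; rewrite mule_ge0.
rewrite /fubini_F/=.
under eq_integral do rewrite ge0_integralZl//.
by rewrite ge0_integralZr//; apply: integral_ge0.
Qed.

Lemma measurable_fst_XW (f : TT -> R) : measurable_fun X f ->
  measurable_fun (X `*` W) (fun z => f z.1).
Proof.
move=> mf; apply: (@measurable_comp _ _ _ _ _ _ X) => //.
- by move=> _ [z [? ?] <-].
- exact/measurable_funTS.
Qed.

Lemma measurable_snd_XW (g : RR -> R) : measurable_fun W g ->
  measurable_fun (X `*` W) (fun z => g z.2).
Proof.
move=> mg; apply: (@measurable_comp _ _ _ _ _ _ W) => //.
- by move=> _ [z [? ?] <-].
- exact/measurable_funTS.
Qed.

Hypothesis qw_mean : \int[leb]_(w in W) (w * qw w)%:E = 1.

Definition nu (w : RR) : R := (w * qw w)%R.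

Lemma measurable_nu : measurable_fun W nu.
Proof.
apply: measurable_funM; last exact: density_measurable.
exact: measurable_funTS.
Qed.

Lemma nu_ge0 w : W w -> (0 <= nu w)%R.
Proof. move=> Ww; apply: mulr_ge0; [exact: W0|exact: density_ge0]. Qed.

Lemma pm_target_measurable :
  measurable_fun (X `*` W) (fun z => pi z.1 * nu z.2)%R.
Proof.
apply: measurable_funM; last by apply: measurable_snd_XW; exact: measurable_nu.
by apply: measurable_fst_XW; exact: density_measurable.
Qed.

Lemma pm_target_ge0 z : (X `*` W) z -> (0 <= pi z.1 * nu z.2)%R.
Proof. by move=> [? ?]; rewrite mulr_ge0 ?density_ge0//; exact: nu_ge0. Qed.

Lemma pm_target_int : \int[lebdw]_(z in X `*` W) (pi z.1 * nu z.2)%:E = 1.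
Proof.
rewrite tonelliXW.
- by rewrite density_int mul1e.
- exact: density_measurable.
- exact: density_ge0.
- exact: measurable_nu.
- exact: nu_ge0.
Qed.

Definition pm_target_density : density lebdw (X `*` W) :=
  Density pm_target_measurable pm_target_ge0 pm_target_int.

Definition pm_target : probability (TT * RR)%type R :=
  density_prob measurable_XW pm_target_density.

Lemma measurable_switch2 (f : TT -> TT -> R) (g : RR -> RR -> R) :
  measurable_fun (X `*` X) (fun z : TT * TT => f z.1 z.2) ->
  measurable_fun (W `*` W) (fun z : RR * RR => g z.1 z.2) ->
  measurable_fun ((X `*` W) `*` (X `*` W))
    (fun z : (TT * RR) * (TT * RR) => f z.1.1 z.2.1 * g z.1.2 z.2.2)%R.
Proof.
move=> mf mg; have mXWXW : measurable ((X `*` W) `*` (X `*` W)).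
  by apply: measurableX; exact: measurable_XW.
apply: measurable_funM.
  rewrite (_ : (fun z => _) = (fun z : TT * TT => f z.1 z.2) \o
    (fun z : (TT * RR) * (TT * RR) => (z.1.1, z.2.1)))//.
  apply: (@measurable_comp _ _ _ _ _ _ (X `*` X)) => //.
  - exact: measurableX.
  - by move=> _ [z [[? ?] [? ?]] <-]; split.
  - apply: measurable_funTS; apply: measurable_fun_pair => /=;
    exact: measurableT_comp.
rewrite (_ : (fun z => _) = (fun z : RR * RR => g z.1 z.2) \o
  (fun z : (TT * RR) * (TT * RR) => (z.1.2, z.2.2)))//.
apply: (@measurable_comp _ _ _ _ _ _ (W `*` W)) => //.
- exact: measurableX.
- by move=> _ [z [[? ?] [? ?]] <-]; split.
- apply: measurable_funTS; apply: measurable_fun_pair => /=;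
  exact: measurableT_comp.
Qed.

Lemma pm_proposal_measurable : measurable_fun ((X `*` W) `*` (X `*` W))
  (fun z : (TT * RR) * (TT * RR) => q z.1.1 z.2.1 * qw z.2.2)%R.
Proof.
apply: (measurable_switch2 (g := fun _ => qw)).
  exact: proposal_measurable.
apply: (@measurable_comp _ _ _ _ _ _ W) => //.
- by move=> _ [z [? ?] <-].
- exact: density_measurable.
- exact/measurable_funTS.
Qed.

Lemma pm_proposal_ge0 (z z' : TT * RR) : (X `*` W) z -> (X `*` W) z' ->
  (0 <= q z.1 z'.1 * qw z'.2)%R.
Proof.
by move=> [? ?] [? ?]; rewrite mulr_ge0 ?proposal_ge0 ?density_ge0.
Qed.

Lemma pm_proposal_int (z : TT * RR) : (X `*` W) z ->
  \int[lebdw]_(z' in X `*` W) (q z.1 z'.1 * qw z'.2)%:E = 1.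
Proof.
move=> [Xz Wz]; rewrite (@tonelliXW (q z.1)).
- by rewrite proposal_int// density_int mul1e.
- rewrite (_ : q z.1 = (fun z => q z.1 z.2) \o (pair z.1))//.
  apply: (@measurable_comp _ _ _ _ _ _ (X `*` X)) => //.
  + exact: measurableX.
  + by move=> _ [y Sy <-]; split.
  + exact: proposal_measurable.
  + exact/measurable_funTS/pair1_measurable.
- by move=> x Xx; exact: proposal_ge0.
- exact: density_measurable.
- exact: density_ge0.
Qed.

Definition pm_proposal : proposal lebdw (X `*` W) :=
  Proposal pm_proposal_measurable pm_proposal_ge0 pm_proposal_int.

Definition pm_ratio (z z' : TT * RR) : R :=
  (mh_ratio z.1 z'.1 * (z'.2 / z.2))%R.

Lemma measurable_pm_ratio : measurable_fun ((X `*` W) `*` (X `*` W))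
  (fun z : (TT * RR) * (TT * RR) => pm_ratio z.1 z.2).
Proof.
apply: (measurable_switch2 (g := fun w w' => (w' / w)%R)).
  exact: measurable_mh_ratio.
apply: measurable_funM; first exact: measurable_funTS.
by apply: (measurableT_comp (@measurable_inv R)); exact: measurable_funTS.
Qed.

Lemma pm_ratio_ge0 z z' : (X `*` W) z -> (X `*` W) z' -> (0 <= pm_ratio z z')%R.
Proof.
by move=> [? ?] [? ?]; rewrite mulr_ge0 ?mh_ratio_ge0// divr_ge0 ?W0.
Qed.

Definition pm_kernel : R.-pker (TT * RR)%type ~> (TT * RR)%type :=
  metropolis_kernel measurable_XW pm_proposal measurable_pm_ratio pm_ratio_ge0.

End pseudo_marginal.

(* Main.v *)
From HB Require Import structures.
Require Import Defs.
From mathcomp Require Import all_boot all_order all_algebra.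
From mathcomp Require Import all_classical all_reals all_analysis.
From mathcomp Require Import measurable_realfun.
From mathcomp Require Import ring lra zify.
Import Order.TTheory GRing.Theory Num.Theory.
Import numFieldNormedType.Exports.

(* Write gamma_k = <h, P^k h> for a bounded centred h and a reversible kernel P.
   The averages U_m of two consecutive partial sums of the gamma_k have
   increments ||(1 + P) P^m h||^2 / 2 >= 0, so that the scaled variances converge
   to - gamma_0 + 2 sup U_m. If <h, g>^2 <= C <g, (I - P) g> for all bounded g,
   then testing with the approximate solution g of (I - P) g = h gives U_m <= C,
   without any spectral theorem; truncation then removes the boundedness of h.

   For the pseudo-marginal kernel and h depending on theta only, <h, g> depends
   on g only through its average gbar(theta) = \int g(theta, w) nu(w) dw. The
   flow of P_pm dominates min(w, w') q~(w) q~(w') times the flow of P_MH, and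
   w w' = max(w, w') min(w, w'), so that the Cauchy-Schwarz inequality yields
   E_MH(gbar) <= R_S E_pm(g). With the gap of P_MH this gives the bound above
   with C = (R_S / eps_MH) Var(h). *)

Set Implicit Arguments.
Unset Strict Implicit.
Unset Printing Implicit Defensive.

Local Open Scope classical_set_scope.
Local Open Scope ring_scope.
Local Open Scope ereal_scope.

(** * Bounded measurable functions *)

(** Only a right gap is assumed, so -1 may lie in the spectrum of P and the gamma_k may alternate:
    their partial sums need neither increase nor converge. Averaging two consecutive ones weights
    three neighbouring gammas by 1, 2, 1, which is a square, so that the limit exists in [0, +oo]
    before any bound is known. Operators act on everywhere bounded functions: integrals against
    [Q x] are then finite at every x, without null sets or L2 classes, and identities extend from
    indicators. The method yields (2 K - 1) Var(h) with K = R_S / eps_MH, whereas the claim has the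
    second moment of h. The exchange needs 2 K - 1 >= 0, which comes from U_0 = gamma_0 / 2 <= K
    gamma_0 for one nonconstant bounded function of theta; it exists because a density on R^d with d
    > 0 has no atoms. The same function shows that the gap is finite: were the infimum over an empty
    set, the coefficient would be -1. The case R_S = +oo is separate because of the convention +oo *
    0 = 0. *)

Section nonnegative_induction.
Context d (T : measurableType d) (R : realType).
Implicit Types (f g : T -> \bar R) (A : set T).
Variable Pr : (T -> \bar R) -> Prop.
Hypothesis Pr_indic : forall A, measurable A -> Pr (EFin \o \1_A).
Hypothesis Pr_comb : forall (r : R) f g, (0 <= r)%R ->
  measurable_fun setT f -> measurable_fun setT g ->
  (forall x, 0 <= f x) -> (forall x, 0 <= g x) ->
  Pr f -> Pr g -> Pr (fun x => r%:E * f x + g x).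
Hypothesis Pr_lim : forall h : (T -> \bar R)^nat,
  (forall n, measurable_fun setT (h n)) -> (forall n x, 0 <= h n x) ->
  (forall x, nondecreasing_seq (h ^~ x)) -> (forall n, Pr (h n)) ->
  Pr (fun x => limn (h ^~ x)).

Import HBNNSimple.

(** Simple functions are nonnegative combinations of indicators, and their increasing limits exhaust
    the nonnegative measurable functions. *)
Lemma ge0_measurable_ind f : measurable_fun setT f -> (forall x, 0 <= f x) ->
  Pr f.
Proof.
move=> mf f0.
pose h := nnsfun_approx measurableT mf.
have -> : f = fun x => limn ((fun n => EFin \o h n) ^~ x).
  apply/funext => x; apply/esym/cvg_lim => //.
  exact: (cvg_nnsfun_approx measurableT mf (fun x _ => f0 x)).
apply: Pr_lim.
- by move=> n; exact/measurable_EFinP.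
- by move=> n x /=; rewrite lee_fin.
- by move=> x m n mn /=; rewrite lee_fin; exact/lefP/nd_nnsfun_approx.
move=> n; set k := h n.
(* An arbitrary list [s] of values allows induction; that it lies in the range of [k] keeps the
   coefficients nonnegative, as [Pr_comb] requires. *)
pose F (s : seq R) x := (\sum_(y <- s) y * \1_(k @^-1` [set y]) x)%R.
suff H (s : seq R) : {subset s <= range k} -> Pr (EFin \o F s).
  rewrite (_ : (k : T -> R) = F (finmap.enum_fset (fset_set (range k)))).
    by apply: H => y; rewrite in_fset_set.
  by apply/funext => x; rewrite fimfunE fsbig_finite.
have mF s' : measurable_fun setT (F s').
  by apply: measurable_sum => y; exact: measurable_funM.
have F0 s' x : {subset s' <= range k} -> (0 <= F s' x)%R.
  move=> s'k; rewrite /F big_seq sumr_ge0// => y /s'k /set_mem [z _ <-].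
  by rewrite mulr_ge0.
elim: s => [_|y s ih ys].
  rewrite (_ : _ \o _ = EFin \o \1_(set0 : set T)); first exact: Pr_indic.
  by apply/funext => x; rewrite /F /= big_nil indic0.
have sk : {subset s <= range k}.
  by move=> z zs; apply: ys; rewrite inE zs orbT.
have y0 : (0 <= y)%R.
  by have /set_mem [z _ <-] := ys _ (mem_head y s).
rewrite (_ : _ \o _ =
    fun x => y%:E * (\1_(k @^-1` [set y]) x)%:E + (F s x)%:E); last first.
  by apply/funext => x; rewrite /F/= big_cons EFinD EFinM.
apply: Pr_comb => //.
- exact/measurable_EFinP.
- exact/measurable_EFinP.
- by move=> x; rewrite lee_fin F0.
- exact: Pr_indic.
- exact: ih.
Qed.

End nonnegative_induction.

Section bounded_measurable.
Local Open Scope ring_scope.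
Context d (T : measurableType d) (R : realType).
Implicit Types (f g : T -> R) (A : set T) (mu : probability T R).

(** The bound holds at every point rather than almost everywhere, so it survives integration against
    [Q x] for every single [x]. *)
Definition bounded_measurable f :=
  measurable_fun setT f /\ exists M : R, forall x, `|f x| <= M.

Lemma bounded_measurable_cst (r : R) : bounded_measurable (cst r).
Proof. by split => //; exists `|r|. Qed.

Lemma bounded_measurable_indic A : measurable A -> bounded_measurable (\1_A).
Proof.
move=> mA; split; first exact: measurable_indic.
by exists 1 => x; rewrite indicE ger0_norm// lern1 leq_b1.
Qed.

Lemma bounded_measurableD f g : bounded_measurable f -> bounded_measurable g ->
  bounded_measurable (fun x => f x + g x).
Proof.
move=> [mf [M fM]] [mg [N gN]]; split; first exact: measurable_funD.
by exists (M + N) => x; rewrite (le_trans (ler_normD _ _))// lerD.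
Qed.

Lemma bounded_measurableM f g : bounded_measurable f -> bounded_measurable g ->
  bounded_measurable (fun x => f x * g x).
Proof.
move=> [mf [M fM]] [mg [N gN]]; split; first exact: measurable_funM.
by exists (M * N) => x; rewrite normrM ler_pM.
Qed.

Lemma bounded_measurableZ (r : R) f : bounded_measurable f ->
  bounded_measurable (fun x => r * f x).
Proof. exact: bounded_measurableM (bounded_measurable_cst r). Qed.

Lemma bounded_measurableN f : bounded_measurable f ->
  bounded_measurable (fun x => - f x).
Proof.
move=> [mf [M fM]]; split; first exact: measurableT_comp.
by exists M => x; rewrite normrN.
Qed.

Lemma bounded_measurableB f g : bounded_measurable f -> bounded_measurable g ->
  bounded_measurable (fun x => f x - g x).
Proof. by move=> bf /bounded_measurableN; exact: bounded_measurableD. Qed.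

Lemma bounded_measurableX f n : bounded_measurable f ->
  bounded_measurable (fun x => f x ^+ n).
Proof.
move=> bf; elim: n => [|n ih]; first exact: (bounded_measurable_cst 1).
by under eq_fun do rewrite exprS; exact: bounded_measurableM.
Qed.

Lemma bounded_integrable (mu : probability T R) f : bounded_measurable f ->
  mu.-integrable setT (EFin \o f).
Proof.
move=> [mf [M fM]]; apply: measurable_bounded_integrable => //.
  by rewrite ltey_eq fin_num_measure.
by exists M; split; [exact: num_real|] => N MN x _ /=; exact/(le_trans (fM x))/ltW.
Qed.

Lemma bounded_RintegralD (mu : probability T R) f g :
  bounded_measurable f -> bounded_measurable g ->
  \int[mu]_x (f x + g x) = \int[mu]_x f x + \int[mu]_x g x.
Proof. by move=> bf bg; rewrite RintegralD//; exact: bounded_integrable. Qed.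

Lemma bounded_RintegralB (mu : probability T R) f g :
  bounded_measurable f -> bounded_measurable g ->
  \int[mu]_x (f x - g x) = \int[mu]_x f x - \int[mu]_x g x.
Proof. by move=> bf bg; rewrite RintegralB//; exact: bounded_integrable. Qed.

Lemma bounded_RintegralZl (mu : probability T R) f r : bounded_measurable f ->
  \int[mu]_x (r * f x) = r * \int[mu]_x f x.
Proof. by move=> bf; rewrite RintegralZl//; exact: bounded_integrable. Qed.

Lemma bounded_Rintegral_cst (mu : probability T R) r : \int[mu]_x r = r.
Proof. by rewrite Rintegral_cst// [X in fine X]probability_setT mulr1. Qed.

Lemma le_bounded_Rintegral (mu : probability T R) f g :
  bounded_measurable f -> bounded_measurable g -> (forall x, f x <= g x) ->
  \int[mu]_x f x <= \int[mu]_x g x.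
Proof.
by move=> bf bg fg; apply: le_Rintegral => //; exact: bounded_integrable.
Qed.

Lemma norm_bounded_Rintegral (mu : probability T R) f (M : R) :
  bounded_measurable f -> (forall x, `|f x| <= M) -> `|\int[mu]_x f x| <= M.
Proof.
move=> bf fM; rewrite ler_norml; apply/andP; split.
  rewrite -[leLHS](bounded_Rintegral_cst mu); apply: le_bounded_Rintegral => //.
    exact: bounded_measurable_cst.
  by move=> x; have := fM x; rewrite ler_norml => /andP[].
rewrite -[leRHS](bounded_Rintegral_cst mu); apply: le_bounded_Rintegral => //.
  exact: bounded_measurable_cst.
by move=> x; have := fM x; rewrite ler_norml => /andP[].
Qed.

Lemma EFin_bounded_Rintegral (mu : probability T R) f : bounded_measurable f ->
  (\int[mu]_x f x)%:E = (\int[mu]_x (f x)%:E)%E.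
Proof.
move=> bf; rewrite /Rintegral fineK//; apply: integrable_fin_num => //.
exact: bounded_integrable.
Qed.

(* a functional on bounded functions that behaves like an integral against a
   finite signed measure *)
Definition bounded_linear (L : (T -> R) -> R) :=
  (forall (a : R) f g, bounded_measurable f -> bounded_measurable g ->
    L (fun x => a * f x + g x) = a * L f + L g) /\
  exists C : R, forall f (M : R), bounded_measurable f -> (forall x, `|f x| <= M) ->
    `|L f| <= C * M.

(* The difference [D] of the functionals vanishes on indicators, and for
   [0 <= f <= 1] one has [f = (1_{f >= 1/2} + f') / 2] with [0 <= f' <= 1], so
   that [|D f| <= |D f'| / 2]; iterating, [D f = 0]. *)
Lemma bounded_linear_eq (L1 L2 : (T -> R) -> R) :
  bounded_linear L1 -> bounded_linear L2 ->
  (forall A, measurable A -> L1 \1_A = L2 \1_A) ->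
  forall f, bounded_measurable f -> L1 f = L2 f.
Proof.
move=> [l1 [C1 b1]] [l2 [C2 b2]] L12.
have LZ (a : R) A : measurable A ->
    L1 (fun x => a * \1_A x) = L2 (fun x => a * \1_A x).
  move=> mA.
  have -> : (fun x => a * \1_A x) =
      (fun x : T => a * \1_A x + \1_(set0 : set T) x) :> (T -> R).
    by apply/funext => x; rewrite indic0 addr0.
  by rewrite l1 ?l2 ?L12//; exact: bounded_measurable_indic.
have half n f : bounded_measurable f -> (forall x, 0 <= f x <= 1) ->
    `|L1 f - L2 f| <= (C1 + C2) * 2^-1 ^+ n.
  elim: n f => [|n ih] f bf f01.
    rewrite expr0 mulrDl (le_trans (ler_normB _ _))// lerD//.
      by apply: b1 => // x; have /andP[f0 f1] := f01 x; rewrite ger0_norm.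
    by apply: b2 => // x; have /andP[f0 f1] := f01 x; rewrite ger0_norm.
  pose A := [set x | 2^-1 <= f x].
  have mA : measurable A.
    have -> : A = f @^-1` `[2^-1, +oo[.
      by apply/seteqP; split => x /=; rewrite in_itv/= andbT.
    by rewrite -[X in measurable X]setTI; apply: bf.1 => //; exact: measurable_itv.
  pose f' x := 2 * f x + - 1 * \1_A x.
  have bA := bounded_measurable_indic mA.
  have bf' : bounded_measurable f'.
    by apply: bounded_measurableD; apply: bounded_measurableZ.
  have fE : f = fun x => 2^-1 * f' x + 2^-1 * \1_A x.
    by apply/funext => x; rewrite /f'; field.
  have b2A : bounded_measurable (fun x => 2^-1 * \1_A x).
    exact: bounded_measurableZ.
  rewrite {1 2}fE l1// l2// LZ// exprS mulrCA.
  rewrite (_ : _ - _ = 2^-1 * (L1 f' - L2 f')); last by ring.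
  rewrite normrM ger0_norm// ler_pM2l//; apply: ih => // x.
  rewrite /f' /A indicE; have /andP[f0 f1] := f01 x.
  have [/set_mem fx|/negP fx] := boolP (x \in A).
    rewrite /A /= in fx.
    by rewrite (_ : true%:R = 1 :> R)//; apply/andP; split; lra.
  have {}fx : f x < 2^-1 by rewrite ltNge; apply/negP => ?; apply: fx; exact/mem_set.
  by rewrite (_ : false%:R = 0 :> R)//; apply/andP; split; lra.
have eq01 f : bounded_measurable f -> (forall x, 0 <= f x <= 1) -> L1 f = L2 f.
  move=> bf f01; apply/eqP; rewrite -subr_eq0 -normr_le0; apply/ler_addgt0Pr => e e0.
  rewrite add0r.
  have : (C1 + C2) * 2^-1 ^+ n @[n --> \oo] --> 0.
    rewrite -[X in _ --> X](mulr0 (C1 + C2)); apply: cvgMr.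
    by apply: cvg_expr; rewrite ger0_norm// invf_lt1// ltr1n.
  move=> /cvgrPdist_le /(_ _ e0)[n _ /(_ n (leqnn n))].
  rewrite sub0r normrN => /(le_trans (ler_norm _)); apply: le_trans.
  exact: half.
move=> f [mf [M fM]].
(* The extra 1 keeps [N] positive even for [f = 0], so that [f / (2 N) + 1/2] has values in
   [0, 1]. *)
pose N : R := `|M| + 1; have N0 : 0 < N by rewrite ltr_wpDl.
have fN x : `|f x| <= N by rewrite (le_trans (fM x))// (le_trans (ler_norm _))// lerDl.
pose f' x := (2 * N)^-1 * f x + 2^-1.
have bf : bounded_measurable f by split => //; exists M.
have bf' : bounded_measurable f'.
  by apply: bounded_measurableD; [exact: bounded_measurableZ|exact: bounded_measurable_cst].
have f'01 x : 0 <= f' x <= 1.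
  rewrite /f'; have := fN x; rewrite ler_norml => /andP[Nf fN'].
  have -> : (2 * N)^-1 * f x + 2^-1 = (f x + N) / (2 * N) by field; rewrite gt_eqF.
  rewrite divr_ge0 ?mulr_ge0//=; [|lra|exact: ltW].
  by rewrite ler_pdivrMr ?mulr_gt0// mul1r; lra.
have fE : f = fun x => (2 * N) * f' x + (- N) * \1_[set: T] x.
  by apply/funext => x; rewrite /f' indicT /=; field; rewrite gt_eqF.
have bT : bounded_measurable (fun x => (- N) * \1_[set: T] x).
  by apply: bounded_measurableZ; exact: bounded_measurable_indic.
by rewrite fE l1// l2// LZ// eq01.
Qed.

End bounded_measurable.

(** The optimal [t] would involve square roots; [t = c / |a|] suffices, since then [t^-1 * c = |a|].
    If [c = 0], the choice [t = |a| / (b + 1)] contradicts [|a| > 0]. *)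
Lemma sqr_le_of_AMGM (R : realFieldType) (a b c : R) : (0 <= b)%R -> (0 <= c)%R ->
  (forall t : R, 0 < t -> 2 * `|a| <= t * b + t^-1 * c)%R -> (a ^+ 2 <= b * c)%R.
Proof.
move=> b0 c0 h; rewrite -real_normK ?num_real//.
have [a0|] := eqVneq `|a|%R 0%R; first by rewrite a0 expr0n mulr_ge0.
rewrite normr_eq0 -normr_gt0; move: `|a|%R h => /= x h x0.
have [c00|cn] := eqVneq c 0%R.
  have b1 : (0 < b + 1)%R by rewrite ltr_wpDl.
  have := h (x / (b + 1))%R (divr_gt0 x0 b1).
  rewrite c00 mulr0 addr0 mulrAC ler_pdivlMr//; nra.
have cgt0 : (0 < c)%R by rewrite lt_neqAle eq_sym cn.
have := h (x^-1 * c)%R; rewrite mulr_gt0 ?invr_gt0// => /(_ isT).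
have -> : ((x^-1 * c)^-1 * c = x)%R by field; rewrite ?gt_eqF.
rewrite -(ler_pM2l x0) mulrDr !mulrA divff ?gt_eqF// mul1r; nra.
Qed.

(** * Reversible Markov operators *)

Section kernel_prob.
Context d (T : measurableType d) (R : realType) (Q : R.-pker T ~> T) (x : T).

(** A copy of [Q x] that carries the structure of a probability, which the lemmas on bounded
    integrands ask for. *)
Definition kernel_prob : set T -> \bar R := Q x.

HB.instance Definition _ := Measure.on kernel_prob.

HB.instance Definition _ := Measure_isProbability.Build _ _ _ kernel_prob
  (@prob_kernel _ _ _ _ _ Q x).

End kernel_prob.

Section markov_operator.
Local Open Scope ring_scope.
Context d (T : measurableType d) (R : realType) (Q : R.-pker T ~> T).
Implicit Types (f g : T -> R) (A : set T).

Definition markov_op f (x : T) : R := \int[kernel_prob Q x]_y f y.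

Lemma markov_op_norm_le f (M : R) x : bounded_measurable f ->
  (forall y, `|f y| <= M) -> `|markov_op f x| <= M.
Proof. exact: norm_bounded_Rintegral. Qed.

Lemma bounded_markov_op f : bounded_measurable f ->
  bounded_measurable (markov_op f).
Proof.
move=> [mf [M fM]]; have bf : bounded_measurable f by split => //; exists M.
split; last by exists M => x; exact: markov_op_norm_le.
(* Measurability in the parameter is applied to a nonnegative integrand, so [f] is shifted by its
   bound [M]; the shift integrates to [M] because [Q x] is a probability. *)
have -> : markov_op f = fun x => fine (\int[Q x]_y (f y + M)%:E)%E - M.
  apply/funext => x; apply/eqP; rewrite -subr_eq opprK.
  rewrite -[X in _ + X](bounded_Rintegral_cst (kernel_prob Q x)).
  by rewrite -bounded_RintegralD//; exact: bounded_measurable_cst.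
apply: measurable_funB => //; apply: measurableT_comp; first exact: fine_measurable.
apply: measurable_fun_integral_kernel.
- exact: measurable_kernel.
- by move=> y; rewrite lee_fin -lerBlDr sub0r; have := fM y; rewrite ler_norml => /andP[].
- by apply/measurable_EFinP; exact: measurable_funD.
Qed.

Lemma markov_op_linear (a : R) f g :
  bounded_measurable f -> bounded_measurable g ->
  markov_op (fun x => a * f x + g x) =
  (fun x => a * markov_op f x + markov_op g x).
Proof.
move=> bf bg; apply/funext => x; rewrite /markov_op bounded_RintegralD//.
  by rewrite bounded_RintegralZl.
exact: bounded_measurableZ.
Qed.

Lemma markov_op_cst (r : R) : markov_op (cst r) = cst r.
Proof. by apply/funext => x; rewrite /markov_op bounded_Rintegral_cst. Qed.

Lemma bounded_iter_markov_op n f : bounded_measurable f ->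
  bounded_measurable (iter n markov_op f).
Proof. by move=> bf; elim: n => //= n ih; exact: bounded_markov_op. Qed.

Lemma markov_op_indic A x : measurable A -> (markov_op \1_A x)%:E = Q x A.
Proof.
move=> mA.
rewrite EFin_bounded_Rintegral; last exact: bounded_measurable_indic.
by rewrite integral_indic// setIT.
Qed.

End markov_operator.

Section paired_sums.
Local Open Scope ring_scope.
Context (R : realType).
Implicit Type (a : nat -> R).

Lemma sum_pairs a m :
  \sum_(k < m + m) a k = \sum_(j < m) (a (j + j)%N + a (j + j).+1).
Proof.
elim: m => [|m ih]; first by rewrite !big_ord0.
by rewrite addSn addnS !big_ord_recr/= ih addrA.
Qed.

(* the average of the partial sums of [a] of lengths [2 m] and [2 m + 1] *)
Definition paired_sum a m := \sum_(k < m + m) a k + 2^-1 * a (m + m)%N.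

Lemma paired_sumS a m : paired_sum a m.+1 =
  paired_sum a m + 2^-1 * (a (m + m)%N + 2 * a (m + m).+1 + a (m + m).+2).
Proof. by rewrite /paired_sum addSn addnS !big_ord_recr/=; field. Qed.

End paired_sums.

Section reversible.
Context d (T : measurableType d) (R : realType).
Variables (mu : probability T R) (Q : R.-pker T ~> T).

(** Symmetry of the measure mu(dx) Q(x, dy), tested on rectangles only; [markov_op_adjoint] extends
    it to bounded functions. *)
Definition reversible := forall A B, measurable A -> measurable B ->
  \int[mu]_(x in A) Q x B = \int[mu]_(x in B) Q x A.

Local Open Scope ring_scope.
Implicit Types (f g : T -> R).

Definition inner f g : R := \int[mu]_x (f x * g x).
Local Notation "''[' f , g ]" := (inner f g) (at level 0, format "''['  f ,  g ]").
Local Notation P := (markov_op Q).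

Lemma innerC f g : '[f, g] = '[g, f].
Proof. by apply: eq_Rintegral => x _; rewrite mulrC. Qed.

Lemma inner_linearl (a : R) f g h : bounded_measurable f ->
  bounded_measurable g -> bounded_measurable h ->
  '[(fun x => a * f x + g x), h] = a * '[f, h] + '[g, h].
Proof.
move=> bf bg bh; rewrite /inner.
under eq_Rintegral do rewrite mulrDl -mulrA.
rewrite bounded_RintegralD ?bounded_RintegralZl//.
- exact: bounded_measurableM.
- by apply: bounded_measurableZ; exact: bounded_measurableM.
- exact: bounded_measurableM.
Qed.

Lemma inner_linearr (a : R) f g h : bounded_measurable f ->
  bounded_measurable g -> bounded_measurable h ->
  '[h, (fun x => a * f x + g x)] = a * '[h, f] + '[h, g].
Proof. by move=> bf bg bh; rewrite innerC inner_linearl// !['[h, _]]innerC. Qed.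

Lemma inner_norm_le f g (M N : R) : bounded_measurable f -> bounded_measurable g ->
  (forall x, `|f x| <= M) -> (forall x, `|g x| <= N) -> `|'[f, g]| <= M * N.
Proof.
move=> bf bg fM gN; apply: norm_bounded_Rintegral.
  exact: bounded_measurableM.
by move=> x; rewrite normrM ler_pM.
Qed.

Lemma inner_ge0 f : 0 <= '[f, f].
Proof. by apply: Rintegral_ge0 => x _; rewrite -expr2 sqr_ge0. Qed.

Lemma bounded_linear_innerr f : bounded_measurable f ->
  bounded_linear (fun g => '[f, g]).
Proof.
move=> bf; split=> [a g h bg bh|]; first exact: inner_linearr.
case: (bf) => _ [M fM]; exists M => g N bg gN; exact: inner_norm_le.
Qed.

Lemma bounded_linear_markov_op (L : (T -> R) -> R) : bounded_linear L ->
  bounded_linear (L \o P).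
Proof.
move=> [Ll [C LC]]; split => [a f g bf bg|]/=.
  by rewrite markov_op_linear// Ll//; exact: bounded_markov_op.
exists C => f M bf fM /=; apply: LC; first exact: bounded_markov_op.
by move=> x; exact: markov_op_norm_le.
Qed.

Hypothesis Qrev : reversible.

(** Both sides are bounded linear in [g] and in [f], so two applications of [bounded_linear_eq]
    leave indicators, for which this is detailed balance. *)
Lemma markov_op_adjoint f g : bounded_measurable f -> bounded_measurable g ->
  '[f, P g] = '[P f, g].
Proof.
move=> bf bg; rewrite [RHS]innerC; move: g bg.
apply: bounded_linear_eq.
- apply: (bounded_linear_markov_op (L := fun g => '[f, g])).
  exact: bounded_linear_innerr.
- split=> [a g h bg bh|].
    by rewrite inner_linearl//; exact: bounded_markov_op.
  case: (bf) => _ [M fM]; exists M => g N bg gN; rewrite mulrC.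
  apply: inner_norm_le => //; first exact: bounded_markov_op.
  by move=> x; exact: markov_op_norm_le.
move=> B mB; have bB := bounded_measurable_indic R mB; move: f bf.
apply: (bounded_linear_eq (L1 := fun f => '[f, P \1_B])
                          (L2 := fun f => '[\1_B, P f])).
- split=> [a g h bg bh|].
    by rewrite inner_linearl//; exact: bounded_markov_op.
  exists 1 => g N bg gN; rewrite mulrC.
  apply: inner_norm_le => //; first exact: bounded_markov_op.
  move=> x; apply: markov_op_norm_le => //.
  by move=> y; rewrite indicE ger0_norm// lern1 leq_b1.
- apply: (bounded_linear_markov_op (L := fun g => '[\1_B, g])).
  exact: bounded_linear_innerr.
have E A' B' : measurable A' -> measurable B' ->
    ('[\1_A', P \1_B'])%:E = (\int[mu]_(x in A') Q x B')%E.
  move=> mA' mB'; rewrite EFin_bounded_Rintegral; last first.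
    apply: bounded_measurableM; first exact: bounded_measurable_indic.
    by apply: bounded_markov_op; exact: bounded_measurable_indic.
  rewrite [RHS]integral_mkcond; apply: eq_integral => x _.
  rewrite patchE -(markov_op_indic Q x mB') indicE.
  by case: ifPn => _; rewrite ?mul1r ?mul0r.
by move=> A mA; apply: EFin_inj; rewrite !E//; exact: Qrev.
Qed.

Lemma Rintegral_markov_op f : bounded_measurable f ->
  \int[mu]_x P f x = \int[mu]_x f x.
Proof.
move=> bf; have := markov_op_adjoint (bounded_measurable_cst T (1 : R)) bf.
rewrite markov_op_cst /inner/=.
by under eq_Rintegral do rewrite mul1r; under [RHS]eq_Rintegral do rewrite mul1r.
Qed.

(** One expansion serves both signs: [s = 1] gives positivity of I + P, [s = -1] the Dirichlet form.
    The square of [f y] integrates to ['[f, f]] by invariance of [mu]. *)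
Let sqr_form (s : R) f : bounded_measurable f ->
  \int[mu]_x \int[kernel_prob Q x]_y (f y + s * f x) ^+ 2 =
  '[f, f] + 2 * s * '[f, P f] + s ^+ 2 * '[f, f].
Proof.
move=> bf; have bf2 := bounded_measurableX 2 bf; have bPf := bounded_markov_op Q bf.
under eq_Rintegral.
  move=> x _; under eq_Rintegral.
    move=> y _.
    rewrite (_ : _ ^+ 2 = (2 * s * f x) * f y + (f y ^+ 2 + (s * f x) ^+ 2)); last by ring.
    over.
  rewrite bounded_RintegralD; [|exact: bounded_measurableZ|].
    rewrite bounded_RintegralZl// bounded_RintegralD//; last exact: bounded_measurable_cst.
    rewrite bounded_Rintegral_cst -![\int[kernel_prob Q x]_y _]/(P _ x).
    rewrite (_ : _ + _ = 2 * s * (f x * P f x) + (P (fun y => f y ^+ 2) x + s ^+ 2 * (f x * f x))); last by ring.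
    over.
  by apply: bounded_measurableD => //; exact: bounded_measurable_cst.
have bfPf := bounded_measurableM bf bPf.
have bff := bounded_measurableM bf bf.
rewrite bounded_RintegralD ?bounded_RintegralZl ?bounded_RintegralD ?bounded_RintegralZl//.
- rewrite Rintegral_markov_op// /inner addrCA addrA.
  by congr (_ + _ + _); apply: eq_Rintegral => x _; rewrite expr2.
- exact: bounded_markov_op.
- exact: bounded_measurableZ.
- exact: bounded_measurableZ.
- apply: bounded_measurableD; last exact: bounded_measurableZ.
  exact: bounded_markov_op.
Qed.

Lemma inner_markov_op_geN f : bounded_measurable f ->
  0 <= '[f, f] + '[f, P f].
Proof.
move=> bf; have := sqr_form 1 bf.
have : 0 <= \int[mu]_x \int[kernel_prob Q x]_y (f y + 1 * f x) ^+ 2.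
  by apply: Rintegral_ge0 => x _; apply: Rintegral_ge0 => y _; exact: sqr_ge0.
by move=> /[swap] ->; lra.
Qed.

Lemma dirichletE f : bounded_measurable f ->
  dirichlet mu Q f = ('[f, f] - '[f, P f])%:E.
Proof.
move=> bf; have := sqr_form (-1) bf.
have [mf [M fM]] := bf.
have bsq x : bounded_measurable (fun y => (f y + - 1 * f x) ^+ 2).
  by apply: bounded_measurableX; apply: bounded_measurableD => //; exact: bounded_measurable_cst.
rewrite /dirichlet => E.
have -> : (\int[mu]_x \int[Q x]_y ((f y - f x) ^+ 2)%:E)%E =
    (\int[mu]_x \int[kernel_prob Q x]_y (f y + - 1 * f x) ^+ 2)%:E.
  rewrite EFin_bounded_Rintegral.
    apply: eq_integral => x _; rewrite EFin_bounded_Rintegral//.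
    by apply: eq_integral => y _; rewrite mulN1r.
  (* Expanded through P, the inner integral is seen to be bounded and measurable in [x], which
     licenses the passage from extended to real integrals. *)
  have -> : (fun x => \int[kernel_prob Q x]_y (f y + - 1 * f x) ^+ 2) =
     fun x => (- 2 * (f x * P f x) + (P (fun y => f y ^+ 2) x + (f x * f x))).
    apply/funext => x.
    under eq_Rintegral.
      move=> y _.
      rewrite (_ : _ ^+ 2 = (- 2 * f x) * f y + (f y ^+ 2 + (f x) ^+ 2)); last by ring.
      over.
    rewrite bounded_RintegralD; [|exact: bounded_measurableZ|].
      rewrite bounded_RintegralZl// bounded_RintegralD//.
      - by rewrite bounded_Rintegral_cst /markov_op; ring.
      - exact: bounded_measurableX.
      - exact: bounded_measurable_cst.
    apply: bounded_measurableD; last exact: bounded_measurable_cst.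
    exact: bounded_measurableX.
  apply: bounded_measurableD.
    by apply: bounded_measurableZ; apply: bounded_measurableM => //; exact: bounded_markov_op.
  apply: bounded_measurableD; last exact: bounded_measurableM.
  by apply: bounded_markov_op; exact: bounded_measurableX.
by rewrite E -EFinM; congr EFin; field.
Qed.

Section autocovariances.
Variable h : T -> R.
Hypothesis bh : bounded_measurable h.

Definition autocov k := '[h, iter k P h].

Local Notation Pk k := (iter k P h).

Let bP k : bounded_measurable (Pk k). Proof. exact: bounded_iter_markov_op. Qed.

Lemma inner_iter i j : '[Pk i, Pk j] = autocov (i + j).
Proof.
elim: i j => [|i ih j]; first by [].
by rewrite iterS -(markov_op_adjoint (bP i) (bP j)) -(iterS j P) ih addnS.
Qed.

(** Positivity of I + P at P^k h. The first index must be even: for an odd one the sign of P itself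
    would enter. *)
Lemma autocov_pair_ge0 k : 0 <= autocov (k + k) + autocov (k + k).+1.
Proof.
have := inner_markov_op_geN (bP k).
by rewrite -(iterS k P) !inner_iter addnS.
Qed.

Lemma autocov_triple_ge0 k :
  0 <= autocov (k + k) + 2 * autocov (k + k).+1 + autocov (k + k).+2.
Proof.
have := inner_ge0 (fun x => 1 * Pk k x + Pk k.+1 x).
rewrite inner_linearl ?inner_linearr//; last first.
  by apply: bounded_measurableD => //; exact: bounded_measurableZ.
by rewrite !inner_iter !(addnS, addSn); lra.
Qed.

(** The truncated Neumann series for (I - P)^{-1} h. *)
Let A n x := \sum_(k < n) Pk k x.

Let bA n : bounded_measurable (A n).
Proof.
elim: n => [|n ih].
  rewrite (_ : A 0 = cst 0); first exact: bounded_measurable_cst.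
  by apply/funext => x; rewrite /A big_ord0.
rewrite (_ : A n.+1 = fun x => A n x + Pk n x).
  exact: bounded_measurableD.
by apply/funext => x; rewrite /A big_ord_recr.
Qed.

Let PA n : P (A n) = fun x => A n x + (- 1 * h x + Pk n x).
Proof.
elim: n => [|n ih].
  rewrite (_ : A 0 = cst 0).
    by rewrite markov_op_cst; apply/funext => x /=; ring.
  by apply/funext => x; rewrite /A big_ord0.
rewrite (_ : A n.+1 = fun x => 1 * Pk n x + A n x).
  rewrite markov_op_linear// ih; apply/funext => x /=.
  by ring.
by apply/funext => x; rewrite /A big_ord_recr/= mul1r addrC.
Qed.

Let innerA n j : '[A n, Pk j] = \sum_(k < n) autocov (k + j).
Proof.
elim: n => [|n ih].
  rewrite (_ : A 0 = cst 0); last by apply/funext => x; rewrite /A big_ord0.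
  rewrite big_ord0 /inner; under eq_Rintegral do rewrite mul0r.
  exact: bounded_Rintegral_cst.
rewrite big_ord_recr/= -ih (_ : A n.+1 = fun x => 1 * A n x + Pk n x).
  by rewrite inner_linearl// inner_iter mul1r.
by apply/funext => x; rewrite /A big_ord_recr/= mul1r.
Qed.

(* With [u] approximating [(I - P)^{-1} h], one has
   [<h, u> = paired_sum autocov m] and [<u, u - P u> <= <h, u>]. *)
Lemma paired_sum_le (C : R) m : 0 <= C ->
  (forall g, bounded_measurable g ->
    '[h, g] ^+ 2 <= C * ('[g, g] - '[g, P g])) ->
  paired_sum autocov m <= C.
Proof.
move=> C0 hC; pose n := (m + m)%N.
(* The half weight on P^n h makes ['[h, u]] the paired sum and gives (I - P) u = h - (P^n h +
   P^{n+1} h) / 2. *)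
pose u x := 2^-1 * Pk n x + A n x.
have bu : bounded_measurable u.
  by apply: bounded_measurableD => //; exact: bounded_measurableZ.
have uP j : '[u, Pk j] = 2^-1 * autocov (n + j) + \sum_(k < n) autocov (k + j).
  by rewrite inner_linearl// inner_iter innerA.
have uh : '[h, u] = paired_sum autocov m.
  rewrite innerC -[h]/(Pk 0) uP addn0 /paired_sum addrC; congr (_ + _).
  by apply: eq_bigr => k _; rewrite addn0.
have PuE : P u =
    fun x => - 1 * h x + (2^-1 * Pk n x + (2^-1 * Pk n.+1 x + u x)).
  by rewrite markov_op_linear// PA; apply/funext => x; rewrite /u iterS; field.
have b1 : bounded_measurable (fun x => 2^-1 * Pk n.+1 x + u x).
  by apply: bounded_measurableD => //; exact: bounded_measurableZ.
have b2 : bounded_measurable (fun x => 2^-1 * Pk n x + (2^-1 * Pk n.+1 x + u x)).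
  by apply: bounded_measurableD => //; exact: bounded_measurableZ.
have uPu : '[u, u] - '[u, P u] <= '[h, u].
  rewrite PuE; clearbody u; rewrite inner_linearr ?inner_linearr// !uP (innerC u h).
  have H1 : 0 <= autocov (n + n) + autocov (n + n.+1).
    by rewrite addnS; exact: autocov_pair_ge0.
  (* As [n = 2 m], the terms [2 j] and [2 j + 1] combine to a 1, 2, 1 triple that starts at the even
     index [2 (j + m)]. *)
  have H2 : 0 <= \sum_(k < n) autocov (k + n) + \sum_(k < n) autocov (k + n.+1).
    rewrite -big_split/= (sum_pairs (fun k => autocov (k + n) + autocov (k + n.+1))).
    apply: sumr_ge0 => j _; have := autocov_triple_ge0 (j + m).
    rewrite !addSn !addnS (_ : (j + m + (j + m) = j + j + n)%N); last by rewrite /n; lia.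
    by lra.
  by lra.
have := hC u bu; rewrite -uh; move: uPu; set U := '[h, u]; set D := _ - _ => DU UD.
(* If [U > 0], then [U ^+ 2 <= C * D <= C * U], and [U] cancels. *)
have [U0|U0] := leP U 0; first exact: le_trans C0.
rewrite -(ler_pM2r U0) -expr2 (le_trans UD)//; exact: ler_wpM2l.
Qed.

End autocovariances.

End reversible.

(** * Means of Toeplitz sums *)

Section paired_sum_limits.
Local Open Scope ring_scope.
Context (R : realType).
Implicit Type (a : nat -> R).

(** From [n] to [n + 1], the new row and column each contribute a_1 + ... + a_n and the corner a_0:
    in total twice the partial sum of length [n + 1], minus a_0. *)
Lemma sum_toeplitz (g : nat -> nat -> R) a n :
  (forall i j, g i j = g j i) -> (forall i k, g i (i + k)%N = a k) ->
  \sum_(i < n) \sum_(j < n) g i j =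
  2 * (\sum_(m < n.+1) \sum_(k < m) a k) - n%:R * a 0%N.
Proof.
move=> gC ga; elim: n => [|n ih].
  by rewrite big_ord_recr !big_ord0/=; ring.
rewrite big_ord_recr/=; under eq_bigr do rewrite big_ord_recr/=.
rewrite big_split/= [X in _ + X = _]big_ord_recr/= ih [in RHS]big_ord_recr/=.
have -> : \sum_(i < n) g i n = \sum_(i < n) a i.+1.
  rewrite (reindex_inj rev_ord_inj); apply: eq_bigr => i _ /=.
  by rewrite -(ga (n - i.+1)%N); congr g; have := ltn_ord i; lia.
have -> : \sum_(i < n) g n i = \sum_(i < n) a i.+1.
  rewrite (reindex_inj rev_ord_inj); apply: eq_bigr => i _ /=.
  by rewrite gC -(ga (n - i.+1)%N); congr g; have := ltn_ord i; lia.
have -> : g n n = a 0%N by rewrite -(ga n) addn0.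
rewrite [X in _ = 2 * (_ + X) - _]big_ord_recl/= -[n.+1%:R]natr1.
by rewrite -[X in a 0%N + X]/(\sum_(i < n) a i.+1); ring.
Qed.

(** The partial sums of lengths [2 j] and [2 j + 1] add up to twice [paired_sum a j]; for even [n]
    the one of length [n] has no partner. *)
Lemma sum_partial_sums a n : \sum_(m < n.+1) \sum_(k < m) a k =
  2 * (\sum_(j < uphalf n) paired_sum a j) +
  (if odd n then 0 else \sum_(k < n) a k).
Proof.
have E N : \sum_(m < N + N) \sum_(k < m) a k = 2 * (\sum_(j < N) paired_sum a j).
  rewrite (sum_pairs (fun m => \sum_(k < m) a k)) mulr_sumr; apply: eq_bigr => j _.
  by rewrite /paired_sum big_ord_recr/=; field.
have := odd_double_half n; rewrite uphalf_half -addnn.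
move: (odd n) (n./2) => [] N <- /=.
  by rewrite add1n -addSn -addnS E addr0.
by rewrite !add0n big_ord_recr/= E.
Qed.

Lemma cvg_pred_half : n.-1./2 @[n --> \oo] --> \oo.
Proof.
move=> A [N _ NA]; exists (N + N).+1 => // n /= Nn; apply: NA => /=.
by have := odd_double_half n.-1; rewrite -addnn; lia.
Qed.

(** [arithmetic_mean u n] averages [n + 1] terms, hence the index [n.-1./2] for a mean of [uphalf n]
    terms. *)
Lemma pred_halfS n : (0 < n)%N -> (n.-1./2).+1 = uphalf n.
Proof. by case: n. Qed.

Section limits.
Variable a : nat -> R.
Hypothesis a_max : forall k, `|a k| <= a 0%N.
Hypothesis ndU : nondecreasing_seq (paired_sum a).

Let V n : R := (2 * (\sum_(m < n.+1) \sum_(k < m) a k) - n%:R * a 0%N) / n%:R.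

Let a0 : 0 <= a 0%N. Proof. exact: le_trans (normr_ge0 _) (a_max 0). Qed.

Let U0 : paired_sum a 0 = 2^-1 * a 0%N.
Proof. by rewrite /paired_sum big_ord0 add0r. Qed.

Let psumE N : \sum_(k < N + N) a k = paired_sum a N - 2^-1 * a (N + N)%N.
Proof. by rewrite /paired_sum addrK. Qed.

(** By monotonicity of the paired sums and maximality of [a 0], the sum is at least
    [paired_sum a 0 - a 0 / 2 = 0]. *)
Let psum_ge0 N : 0 <= \sum_(k < N + N) a k.
Proof.
rewrite psumE subr_ge0; apply: (le_trans _ (ndU (leq0n N))).
by rewrite U0 ler_pM2l ?invr_gt0// (le_trans (ler_norm _)).
Qed.

Let psum_le N : \sum_(k < N + N) a k <= paired_sum a N + 2^-1 * a 0%N.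
Proof.
rewrite psumE lerD2l -mulrN ler_pM2l ?invr_gt0// (le_trans (ler_norm _))//.
by rewrite normrN.
Qed.

Let even_sum n : ~~ odd n -> \sum_(k < n) a k = \sum_(k < n./2 + n./2) a k.
Proof.
move=> /negbTE on; have := odd_double_half n; rewrite on add0n -addnn.
by move: (n./2) => N <-.
Qed.

Let VE n : (0 < n)%N ->
  V n = 4 * (uphalf n)%:R / n%:R * arithmetic_mean (paired_sum a) n.-1./2 +
        2 * (if odd n then 0 else \sum_(k < n) a k) / n%:R - a 0%N.
Proof.
move=> n0; rewrite /V sum_partial_sums /arithmetic_mean/= /series/= big_mkord pred_halfS//.
have u0 : (uphalf n)%:R != 0 :> R.
  by rewrite pnatr_eq0 uphalf_half; have := odd_double_half n; rewrite -addnn; lia.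
have nn0 : n%:R != 0 :> R by rewrite pnatr_eq0; lia.
by field; rewrite u0 nn0.
Qed.

Let cvg_coef : 4 * (uphalf n)%:R / n%:R @[n --> \oo] --> (2 : R).
Proof.
apply/cvgrPdist_le => e e0; near=> n.
have n0 : (0 < n)%N by near: n; exists 1%N.
have nn0 : 0 < n%:R :> R by rewrite ltr0n.
have -> : 2 - 4 * (uphalf n)%:R / n%:R = - 2 * (odd n)%:R / n%:R :> R.
  have : (uphalf n + uphalf n = n + odd n)%N.
    by rewrite uphalf_half; have := odd_double_half n; rewrite -addnn; lia.
  move=> /(congr1 (fun k => k%:R : R)); rewrite !natrD => E.
  have -> : (uphalf n)%:R = (n%:R + (odd n)%:R) / 2 :> R by rewrite -E; field.
  by field; rewrite gt_eqF.
have H2 : 2 * (odd n)%:R / n%:R <= 2 / n%:R :> R.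
  by rewrite ler_pM2r ?invr_gt0// ler_piMr// lern1 leq_b1.
rewrite !mulNr normrN ger0_norm; last by rewrite !mulr_ge0// invr_ge0 ltW.
apply: (le_trans H2); rewrite ler_pdivrMr// -ler_pdivrMl//.
by near: n; exact: nbhs_infty_ger.
Unshelve. all: by end_near. Qed.

(** By [VE] this is a Cesaro mean of the paired sums times a factor tending to 2, plus a bounded
    unpaired sum (doubled) over [n], minus [a 0]. *)
Lemma cvg_toeplitz_mean (L : R) : paired_sum a @ \oo --> L ->
  (2 * (\sum_(m < n.+1) \sum_(k < m) a k) - n%:R * a 0%N) / n%:R @[n --> \oo]
    --> 2 * L - a 0%N.
Proof.
move=> UL; have UleL m : paired_sum a m <= L.
  rewrite -(cvg_lim _ UL)//; apply: nondecreasing_cvgn_le => //.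
  by apply/cvg_ex; exists L.
have L0 : 0 <= L by rewrite (le_trans _ (UleL 0%N))// U0 mulr_ge0.
rewrite -[X in _ --> X - _]addr0.
have : (4 * (uphalf n)%:R / n%:R * arithmetic_mean (paired_sum a) n.-1./2 +
        2 * (if odd n then 0 else \sum_(k < n) a k) / n%:R - a 0%N)
    @[n --> \oo] --> 2 * L + 0 - a 0%N.
  apply: cvgB; last exact: cvg_cst.
  apply: cvgD.
    apply: cvgM; first exact: cvg_coef.
    apply: (cvg_comp _ _ cvg_pred_half); exact: cesaro.
  apply/cvgrPdist_le => e e0; near=> n.
  have n0 : (0 < n)%N by near: n; exists 1%N.
  have nn0 : 0 < n%:R :> R by rewrite ltr0n.
  rewrite sub0r normrN normrM normfV (gtr0_norm nn0) ler_pdivrMr//.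
  rewrite -ler_pdivrMl//.
  have : e^-1 * (2 * (L + 2^-1 * a 0%N)) <= n%:R.
    by near: n; exact: nbhs_infty_ger.
  apply: le_trans; rewrite ler_pM2l ?invr_gt0// normrM ger0_norm// ler_pM2l//.
  case: ifPn => on; first by rewrite normr0 addr_ge0// mulr_ge0.
  rewrite even_sum// ger0_norm// (le_trans (psum_le _))// lerD2r//.
apply: cvg_trans; apply: near_eq_cvg; near=> n.
by apply/esym/VE; near: n; exists 1%N.
Unshelve. all: by end_near. Qed.

Lemma dvg_toeplitz_mean : paired_sum a @ \oo --> +oo ->
  (2 * (\sum_(m < n.+1) \sum_(k < m) a k) - n%:R * a 0%N) / n%:R @[n --> \oo]
    --> +oo.
Proof.
move=> /cvgryPge Uoo; apply/cvgryPge => C.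
(* From index [M] on, the paired sums are at least [|C| + a 0], and for [n >= 4 M] they make up at
   least [n / 4] terms. The total prefactor 4 compensates this, and [a 0] absorbs the subtracted
   diagonal. *)
have [M _ MU] := Uoo (`|C| + a 0%N).
have /= UM := MU M (leqnn M).
near=> n.
have n0 : (0 < n)%N by near: n; exists 1%N.
have nn0 : 0 < n%:R :> R by rewrite ltr0n.
have n4 : (4 * M <= n)%N by near: n; exists (4 * M)%N.
rewrite -/(V n) /V sum_partial_sums ler_pdivlMr//.
have if0 : 0 <= (if odd n then 0 else \sum_(k < n) a k).
  by case: ifPn => // on; rewrite even_sum.
have U_ge0 j : 0 <= paired_sum a j.
  by rewrite (le_trans _ (ndU (leq0n j)))// U0 mulr_ge0.
have nE : (n <= uphalf n + uphalf n)%N.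
  by rewrite uphalf_half; have := odd_double_half n; rewrite -addnn; lia.
have H : (uphalf n - M)%:R * paired_sum a M <= \sum_(j < uphalf n) paired_sum a j.
  rewrite -[leRHS](big_mkord xpredT) (@big_cat_nat _ _ _ M)//=; last by lia.
  rewrite -[leLHS]add0r lerD ?sumr_ge0//.
  rewrite mulr_natl -sumr_const_nat ler_sum_nat// => j /andP[Mj _]; exact: ndU.
have H2 : n%:R / 4 <= (uphalf n - M)%:R :> R.
  rewrite ler_pdivrMr// -natrM ler_nat; lia.
have H3 : n%:R / 4 * (`|C| + a 0%N) <= (uphalf n - M)%:R * paired_sum a M.
  by rewrite ler_pM// ?divr_ge0// addr_ge0.
have H4 : C * n%:R <= n%:R * `|C| by rewrite mulrC ler_pM2l// ler_norm.
nra.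
Unshelve. all: by end_near. Qed.

(** The paired sums are nondecreasing, so they converge or tend to +oo, and the limit exists in both
    cases. Index 0 is left out because of the division by [n]. *)
Lemma toeplitz_mean_limit (v : nat -> \bar R) :
  (forall n, (0 < n)%N -> v n =
    ((2 * (\sum_(m < n.+1) \sum_(k < m) a k) - n%:R * a 0%N) / n%:R)%:E) ->
  cvgn v /\
  forall C : R, (forall m, paired_sum a m <= C) ->
    (limn v <= (2 * C - a 0%N)%:E)%E.
Proof.
move=> vE.
have vV l : (EFin \o V) n @[n --> \oo] --> l -> v @ \oo --> l.
  apply: cvg_trans; apply: near_eq_cvg; near=> n.
  by rewrite /= vE//; near: n; exists 1%N.
have fin (C : R) : (forall m, paired_sum a m <= C) ->
    exists2 L, L <= C & v @ \oo --> (2 * L - a 0%N)%:E.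
  move=> UC; have /nondecreasing_is_cvgn : has_ubound (range (paired_sum a)).
    by exists C => _ [m _ <-].
  move=> /(_ ndU) /cvg_ex[L UL]; exists L.
    rewrite -(cvg_lim _ UL)//; apply: limr_le; last exact: nearW.
    by apply/cvg_ex; exists L.
  by apply: vV; apply: cvg_EFin; [exact: nearW|exact: cvg_toeplitz_mean].
split.
  have [[C UC]|nC] := pselect (exists C : R, forall m, paired_sum a m <= C).
    by have [L _ vL] := fin C UC; apply/cvg_ex; eexists; exact: vL.
  apply/cvg_ex; exists +oo%E; apply: vV; apply/cvgeryP; apply: dvg_toeplitz_mean.
  apply: nondecreasing_dvgn_lt => //.
  move=> /cvg_ex[L UL]; apply: nC; exists L => m.
  rewrite -(cvg_lim _ UL)//; apply: nondecreasing_cvgn_le => //.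
  by apply/cvg_ex; exists L.
move=> C UC; have [L LC vL] := fin C UC.
by rewrite (cvg_lim _ vL)// lee_fin lerD2r ler_pM2l.
Unshelve. all: by end_near. Qed.

End limits.
End paired_sum_limits.

Lemma bounded_measurable_comp d d' (T : measurableType d) (T' : measurableType d')
    (R : realType) (u : T' -> T) (f : T -> R) :
  measurable_fun setT u -> bounded_measurable f -> bounded_measurable (f \o u).
Proof.
move=> mu [mf [M fM]]; split; first exact: measurableT_comp.
by exists M => x; exact: fM.
Qed.

Lemma bounded_linear_inner_comp d d' (T : measurableType d) (T' : measurableType d')
    (R : realType) (P : probability T' R) (F : T' -> R) (u : T' -> T) :
  bounded_measurable F -> measurable_fun setT u ->
  bounded_linear (fun g : T -> R => inner P F (g \o u)).
Proof.
move=> bF mu; split => [a f g bf bg|].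
  rewrite -(@inner_linearr _ _ _ P a (f \o u) (g \o u) F)//;
  exact: bounded_measurable_comp.
case: (bF) => _ [M FM]; exists M => f N bf fN; apply: inner_norm_le => //.
  exact: bounded_measurable_comp.
by move=> x; exact: fN.
Qed.

Lemma cvg_sum_ord (R : realType) (f : nat -> nat -> R) (l : nat -> R) m :
  (forall k, f n k @[n --> \oo] --> l k) ->
  (\sum_(k < m) f n k)%R @[n --> \oo] --> (\sum_(k < m) l k)%R.
Proof.
move=> fl; elim: m => [|m ih].
  by under eq_cvg do rewrite big_ord0; rewrite big_ord0; exact: cvg_cst.
by under eq_cvg do rewrite big_ord_recr/=; rewrite big_ord_recr/=; exact: cvgD.
Qed.

(** * Stationary reversible chains *)

Section truncation.
Local Open Scope ring_scope.
Context d (T : measurableType d) (R : realType).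
Implicit Type h : T -> R.

(** Acting on values, it commutes with composition: truncations of [h \o fst] still depend on theta
    only, and [trunc n h \o Z i] truncates [h \o Z i]. *)
Definition trunc (n : nat) h (x : T) : R := Num.max (- n%:R) (Num.min n%:R (h x)).

Lemma trunc_norm_le n h x : `|trunc n h x| <= `|h x|.
Proof.
rewrite /trunc ler_norml; have := ler0n R n; move: (n%:R : R) => r r0.
have h1 := ler_norm (h x); have h2 := ler_norm (- h x); rewrite normrN in h2.
case: (leP r (h x)) => H1; [case: (leP (- r) r) => H2|case: (leP (- r) (h x)) => H2];
  by apply/andP; split; lra.
Qed.

Lemma bounded_trunc n h : measurable_fun setT h -> bounded_measurable (trunc n h).
Proof.
move=> mh; split.
  by apply: measurable_maxr => //; exact: measurable_minr.
exists n%:R => x; rewrite /trunc ler_norml le_max lexx/= ge_max ge_min lexx/= andbT.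
by rewrite (@le_trans _ _ 0)// oppr_le0.
Qed.

Lemma cvg_trunc h x : trunc n h x @[n --> \oo] --> h x.
Proof.
apply: cvg_near_cst; near=> n.
have : `|h x| <= n%:R by near: n; exact: nbhs_infty_ger.
rewrite ler_norml => /andP[nh hn].
by rewrite /trunc (min_r hn) (max_r nh).
Unshelve. all: by end_near. Qed.

Lemma cvg_Rintegral_trunc (mu : probability T R) (u v : T -> R) :
  measurable_fun setT u -> measurable_fun setT v ->
  mu.-integrable setT (EFin \o (fun x => u x * v x)) ->
  \int[mu]_x (trunc n u x * trunc n v x) @[n --> \oo] --> \int[mu]_x (u x * v x).
Proof.
move=> mu' mv iuv; apply: fine_cvg; rewrite fineK; last exact: integrable_fin_num.
have [| | | | |_ _] := @dominated_convergence _ _ _ mu setT measurableT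
  (fun n x => (trunc n u x * trunc n v x)%:E) (fun x => (u x * v x)%:E)
  (fun x => (`|u x * v x|)%:E).
- move=> n; apply/measurable_EFinP/measurable_funM.
    exact: (bounded_trunc n mu').1.
  exact: (bounded_trunc n mv).1.
- by apply/measurable_EFinP/measurable_funM.
- apply: aeW => x _; apply: cvg_EFin; first exact: nearW.
  by apply: cvgM; exact: cvg_trunc.
- exact: integrable_abse iuv.
- by apply: aeW => x n _; rewrite abse_EFin lee_fin !normrM ler_pM// trunc_norm_le.
- by [].
Qed.

Lemma cvg_Rintegral_trunc1 (mu : probability T R) (u : T -> R) :
  measurable_fun setT u -> mu.-integrable setT (EFin \o u) ->
  \int[mu]_x trunc n u x @[n --> \oo] --> \int[mu]_x u x.
Proof.
move=> mu' iu; apply: fine_cvg; rewrite fineK; last exact: integrable_fin_num.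
have [| | | | |_ _] := @dominated_convergence _ _ _ mu setT measurableT
  (fun n x => (trunc n u x)%:E) (fun x => (u x)%:E) (fun x => (`|u x|)%:E).
- by move=> n; apply/measurable_EFinP; exact: (bounded_trunc n mu').1.
- exact/measurable_EFinP.
- by apply: aeW => x _; apply: cvg_EFin; [exact: nearW|exact: cvg_trunc].
- exact: integrable_abse iu.
- by apply: aeW => x n _; rewrite abse_EFin lee_fin trunc_norm_le.
- by [].
Qed.

End truncation.

Section stationary_chain.
Context d (T : measurableType d) (R : realType).
Variables (mu : probability T R) (Q : R.-pker T ~> T).
Hypothesis Qrev : reversible mu Q.
Context d' (Omega : measurableType d') (P : probability Omega R).
Variable Z : nat -> {RV P >-> T}.
Hypothesis Zchain : markov_chain Z mu Q.

Local Open Scope ring_scope.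
Implicit Types f g : T -> R.

Let mZ n : measurable_fun setT (Z n). Proof. exact: measurable_funPT. Qed.

Let bZ f n : bounded_measurable f -> bounded_measurable (f \o Z n).
Proof. exact: bounded_measurable_comp. Qed.

Let mpre n A : measurable A -> measurable (Z n @^-1` A).
Proof. by move=> mA; rewrite -[X in measurable X]setTI; exact: mZ. Qed.

(** By linearity in [g] and then in [f] only indicators remain; the event that [Z i] is in [B] lies
    in [past n] as [i <= n], so the Markov property applies. *)
Lemma chain_step i n f g : (i <= n)%N ->
  bounded_measurable f -> bounded_measurable g ->
  inner P (f \o Z i) (g \o Z n.+1) = inner P (f \o Z i) (markov_op Q g \o Z n).
Proof.
move=> le_in bf; move: g; apply: bounded_linear_eq.
- by apply: bounded_linear_inner_comp => //; exact: bZ.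
- apply: (@bounded_linear_markov_op _ _ _ Q (fun g => inner P (f \o Z i) (g \o Z n))).
  by apply: bounded_linear_inner_comp => //; exact: bZ.
move=> A mA; have bA := bounded_measurable_indic R mA.
have bQA := bounded_markov_op Q bA.
rewrite innerC [RHS]innerC; move: f bf; apply: bounded_linear_eq.
- by apply: bounded_linear_inner_comp => //; exact: bZ.
- by apply: bounded_linear_inner_comp => //; exact: bZ.
move=> B mB; have bB := bounded_measurable_indic R mB; apply: EFin_inj.
rewrite !EFin_bounded_Rintegral; try by apply: bounded_measurableM; exact: bZ.
transitivity (P (Z i @^-1` B `&` Z n.+1 @^-1` A)).
  transitivity (\int[P]_w (\1_(Z i @^-1` B `&` Z n.+1 @^-1` A) w)%:E)%E.
    by apply: eq_integral => w _; rewrite indicI mulrC.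
  by rewrite integral_indic ?setIT//; apply: measurableI; exact: mpre.
have [_ ->//] := Zchain; last first.
  by apply: sub_sigma_algebra; exists i => //; exists B.
rewrite integral_mkcond; apply: eq_integral => w _.
rewrite patchE /= -(markov_op_indic Q (Z n w) mA) indicE.
by rewrite -[Z i w \in B]/(w \in Z i @^-1` B); case: ifP => _; rewrite ?mulr1 ?mulr0.
Qed.

Lemma chain_inner i k f g : bounded_measurable f -> bounded_measurable g ->
  inner P (f \o Z i) (g \o Z (i + k)%N) =
  inner P (f \o Z i) (iter k (markov_op Q) g \o Z i).
Proof.
move=> bf; elim: k g => [|k ih] g bg; first by rewrite addn0.
rewrite addnS (chain_step (leq_addr k i) bf bg) ih; last exact: bounded_markov_op.
by rewrite -iterSr.
Qed.

(** The mean at time [n] is that of P^n f at time 0, where the law is [mu]; reversibility makes [mu]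
    invariant. *)
Lemma chain_mean n f : bounded_measurable f ->
  \int[P]_w f (Z n w) = \int[mu]_x f x.
Proof.
have H0 g : bounded_measurable g -> inner P (cst 1) (g \o Z 0%N) = inner mu (cst 1) g.
  move: g; apply: bounded_linear_eq.
  - apply: bounded_linear_inner_comp => //; exact: bounded_measurable_cst.
  - exact: bounded_linear_innerr (bounded_measurable_cst _ _).
  move=> A mA; apply: EFin_inj; have bA := bounded_measurable_indic R mA.
  have bZA := bZ 0 bA.
  rewrite !EFin_bounded_Rintegral;
    try by apply: bounded_measurableM => //; exact: bounded_measurable_cst.
  under eq_integral do rewrite mul1r; under [RHS]eq_integral do rewrite mul1r.
  rewrite [RHS]integral_indic// setIT -[RHS](Zchain.1 A mA).
  transitivity (\int[P]_x (\1_(Z 0%N @^-1` A) x)%:E)%E; first exact: eq_integral.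
  by rewrite integral_indic ?setIT//; exact: mpre.
have innerE d1 (T1 : measurableType d1) (m : probability T1 R) (g : T1 -> R) :
    \int[m]_x g x = inner m (cst 1) g.
  by apply: eq_Rintegral => x _; rewrite mul1r.
move=> bf; have b1 := bounded_measurable_cst T (1 : R).
rewrite [LHS]innerE [RHS]innerE.
have := @chain_inner 0 n (cst 1) f b1 bf; rewrite add0n => E.
rewrite [LHS]E H0//; last exact: bounded_iter_markov_op.
elim: n {E} => //= n <-.
by rewrite -!innerE Rintegral_markov_op//; exact: bounded_iter_markov_op.
Qed.

Lemma chain_autocov i k f : bounded_measurable f ->
  inner P (f \o Z i) (f \o Z (i + k)%N) = autocov mu Q f k.
Proof.
move=> bf; rewrite chain_inner//.
apply: (@chain_mean i (fun x => f x * iter k (markov_op Q) f x)).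
by apply: bounded_measurableM => //; exact: bounded_iter_markov_op.
Qed.

Lemma chain_distribution n A : measurable A -> distribution P (Z n) A = mu A.
Proof.
move=> mA; have bA := bounded_measurable_indic R mA.
have := congr1 EFin (chain_mean n bA).
rewrite !EFin_bounded_Rintegral//; last exact: bZ.
rewrite [RHS]integral_indic// setIT => <-.
transitivity (\int[P]_x (\1_(Z n @^-1` A) x)%:E)%E; last exact: eq_integral.
by rewrite integral_indic ?setIT//; exact: mpre.
Qed.

Lemma chain_ge0_integral n (f : T -> \bar R) : measurable_fun setT f ->
  (forall x, 0 <= f x)%E -> (\int[P]_w f (Z n w) = \int[mu]_x f x)%E.
Proof.
move=> mf f0; rewrite -(ge0_integral_distribution (Z n) mf f0).
by apply: eq_measure_integral => A mA _; exact: chain_distribution.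
Qed.

Section square_integrable.
Variable h : T -> R.
Hypothesis hL2 : h \in Lfun mu 2%:E.

Let mh : measurable_fun setT h.
Proof. by have /andP[/[!inE]] := hL2. Qed.

Let hL1 : h \in Lfun mu 1.
Proof. by apply: Lfun_subset12 => //; exact: fin_num_measure. Qed.

Let ih : mu.-integrable setT (EFin \o h). Proof. exact/Lfun1_integrable. Qed.

Let ihh : mu.-integrable setT (EFin \o (fun x => h x * h x)).
Proof. exact/Lfun1_integrable/Lfun2_mul_Lfun1. Qed.

Let ZL2 n : (h \o Z n) \in Lfun P 2%:E.
Proof.
apply/andP; split; rewrite inE/=; first exact: measurableT_comp.
have : finite_norm mu 2%:E h by have /andP[_ /[!inE]] := hL2.
rewrite /finite_norm unlock /=.
rewrite (chain_ge0_integral n (f := fun x => (`|h x| `^ 2)%:E))//.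
apply/measurable_EFinP/(@measurableT_comp _ _ _ _ _ _ (fun x : R => x `^ 2)) => //.
exact: measurableT_comp.
Qed.

Let iZZ i j : P.-integrable setT (EFin \o (fun w => h (Z i w) * h (Z j w))).
Proof. exact/Lfun1_integrable/(Lfun2_mul_Lfun1 (ZL2 i) (ZL2 j)). Qed.

Let iZ i : P.-integrable setT (EFin \o (h \o Z i)).
Proof. by apply/Lfun1_integrable/Lfun_subset12 => //; exact: fin_num_measure. Qed.

(** Defined on [Omega] without iterates of P, which are handled on bounded functions only;
    [cvg_autocov_trunc] is the link to the operator. *)
Definition chain_cov k : R :=
  inner P (h \o Z 0%N) (h \o Z k) - (\int[mu]_x h x) ^+ 2.

Let bt n : bounded_measurable (trunc n h). Proof. exact: bounded_trunc. Qed.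

Let cvg_inner i j : inner P (trunc n h \o Z i) (trunc n h \o Z j) @[n --> \oo] -->
  inner P (h \o Z i) (h \o Z j).
Proof.
apply: (@cvg_Rintegral_trunc _ _ _ P (h \o Z i) (h \o Z j)) => //.
- exact: measurableT_comp.
- exact: measurableT_comp.
- exact: iZZ.
Qed.

Lemma chain_inner_shift i k :
  inner P (h \o Z i) (h \o Z (i + k)%N) = inner P (h \o Z 0%N) (h \o Z k).
Proof.
have := @cvg_inner i (i + k)%N.
under eq_cvg do rewrite (chain_autocov i k (bt _)) -(chain_autocov 0 k (bt _)) add0n.
by move=> /cvg_lim <-//; apply: cvg_lim => //; exact: cvg_inner.
Qed.

Lemma chain_mean_L2 n : \int[P]_w h (Z n w) = \int[mu]_x h x.
Proof.
have : \int[P]_w trunc m h (Z n w) @[m --> \oo] --> \int[P]_w h (Z n w).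
  by apply: (cvg_Rintegral_trunc1 (u := h \o Z n)) => //; exact: measurableT_comp.
under eq_cvg do rewrite (chain_mean n (bt _)).
by move=> /cvg_lim <-//; apply: cvg_lim => //; exact: cvg_Rintegral_trunc1.
Qed.

Definition centered f x := f x - \int[mu]_x f x.

Lemma bounded_centered f : bounded_measurable f -> bounded_measurable (centered f).
Proof. by move=> bf; apply: bounded_measurableB => //; exact: bounded_measurable_cst. Qed.

Lemma autocov_centered f k : bounded_measurable f ->
  autocov mu Q (centered f) k = autocov mu Q f k - (\int[mu]_x f x) ^+ 2.
Proof.
move=> bf; have bc := bounded_centered bf.
rewrite -(chain_autocov 0 k bc) -(chain_autocov 0 k bf) /inner /centered/=.
set m := \int[mu]_x f x.
have bff : bounded_measurable (fun w => f (Z 0%N w) * f (Z k w)).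
  by apply: bounded_measurableM; exact: bZ.
under eq_Rintegral.
  move=> w _.
  rewrite (_ : _ * _ = f (Z 0%N w) * f (Z (0 + k)%N w) +
     (- m * f (Z 0%N w) + (- m * f (Z (0 + k)%N w) + m ^+ 2))); last by ring.
  over.
have bm := bounded_measurable_cst Omega (m ^+ 2).
rewrite bounded_RintegralD//; last first.
  apply: bounded_measurableD; first by apply: bounded_measurableZ; exact: bZ.
  by apply: bounded_measurableD => //; apply: bounded_measurableZ; exact: bZ.
rewrite bounded_RintegralD//; last 2 first.
- by apply: bounded_measurableZ; exact: bZ.
- by apply: bounded_measurableD => //; apply: bounded_measurableZ; exact: bZ.
rewrite bounded_RintegralD//; last by apply: bounded_measurableZ; exact: bZ.
rewrite (bounded_RintegralZl P _ (bZ 0 bf)) (bounded_RintegralZl P _ (bZ k bf)).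
by rewrite bounded_Rintegral_cst !chain_mean// -/m; ring.
Qed.

Lemma cvg_autocov_trunc k :
  autocov mu Q (centered (trunc n h)) k @[n --> \oo] --> chain_cov k.
Proof.
under eq_cvg do rewrite (autocov_centered k (bt _)) -(chain_autocov 0 k (bt _)).
apply: cvgB; first exact: cvg_inner.
by rewrite !expr2; apply: cvgM; exact: cvg_Rintegral_trunc1.
Qed.

Lemma cvg_paired_sum_trunc m :
  paired_sum (autocov mu Q (centered (trunc n h))) m @[n --> \oo] -->
  paired_sum chain_cov m.
Proof.
apply: cvgD; last by apply: cvgMr; exact: cvg_autocov_trunc.
apply: (@cvg_sum_ord _ (fun n k => autocov mu Q (centered (trunc n h)) k) chain_cov).
by move=> k; exact: cvg_autocov_trunc.
Qed.

Lemma paired_sum_chain_cov_nd : nondecreasing_seq (paired_sum chain_cov).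
Proof.
apply/nondecreasing_seqP => m.
apply: (ler_cvg_to (@cvg_paired_sum_trunc m) (@cvg_paired_sum_trunc m.+1)).
apply: nearW => n; rewrite paired_sumS lerDl mulr_ge0//.
by apply: autocov_triple_ge0 => //; exact: bounded_centered.
Qed.

(** For a centred truncation c and [s] equal to 1 or -1, the square of s c(Z_0) + c(Z_k) has a
    nonnegative mean, and by stationarity c(Z_0) and c(Z_k) have the same second moment. *)
Lemma chain_cov_norm_le k : `|chain_cov k| <= chain_cov 0%N.
Proof.
have H (s : R) : `|s| = 1 -> 0 <= chain_cov 0%N + s * chain_cov k.
  move=> s1; have s2 : s ^+ 2 = 1 by rewrite -[s ^+ 2]real_normK ?num_real// s1 expr1n.
  have C : (fun n => autocov mu Q (centered (trunc n h)) 0%N +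
      s * autocov mu Q (centered (trunc n h)) k) @ \oo --> chain_cov 0%N + s * chain_cov k.
    by apply: cvgD; [|apply: cvgMr]; exact: cvg_autocov_trunc.
  rewrite -(cvg_lim _ C)//; apply: limr_ge; first by apply/cvg_ex; eexists; exact: C.
  apply: nearW => n; have bc := bounded_centered (bt n).
  set c := centered _ in bc *.
  have : 0 <= inner P (fun w => s * c (Z 0%N w) + c (Z k w)) (fun w => s * c (Z 0%N w) + c (Z k w)).
    exact: inner_ge0.
  have b0 := bZ 0 bc; have bk := bZ k bc.
  have bs : bounded_measurable (fun w => s * (c \o Z 0%N) w + (c \o Z k) w).
    by apply: bounded_measurableD => //; exact: bounded_measurableZ.
  rewrite (inner_linearl P s b0 bk bs) (inner_linearr P s b0 bk b0) (inner_linearr P s b0 bk bk).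
  rewrite (innerC P (c \o Z k)).
  have := chain_autocov 0 k bc; rewrite add0n => ->.
  have := chain_autocov 0 0 bc; rewrite addn0 => ->.
  have := chain_autocov k 0 bc; rewrite addn0 => ->.
  have -> : s * (s * autocov mu Q c 0%N + autocov mu Q c k) + (s * autocov mu Q c k + autocov mu Q c 0%N)
     = (s ^+ 2 + 1) * autocov mu Q c 0%N + 2 * (s * autocov mu Q c k) by ring.
  by rewrite s2; lra.
rewrite ler_norml; have := H 1 (normr1 _); have := H (-1); rewrite normrN1 => /(_ erefl).
by move=> H1 H2; apply/andP; split; lra.
Qed.

Let cov_chain i j : covariance P (h \o Z i) (h \o Z j) =
  (inner P (h \o Z i) (h \o Z j) - (\int[mu]_x h x) ^+ 2)%:E.
Proof.
rewrite covarianceE//; [|exact/Lfun1_integrable|exact/Lfun1_integrable|exact: Lfun2_mul_Lfun1].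
rewrite unlock.
have E n : (\int[P]_w ((h \o Z n) w)%:E = (\int[mu]_x h x)%:E)%E.
  by rewrite -(chain_mean_L2 n) /Rintegral fineK//; exact: integrable_fin_num (iZ n).
rewrite !E EFinB -EFinM -expr2; congr (_ - _)%E.
by rewrite /inner /Rintegral fineK//; exact: integrable_fin_num (iZZ i j).
Qed.

Let sumL2 n : (fun w => \sum_(i < n) h (Z i w)) \in Lfun P 2%:E.
Proof.
rewrite (_ : (fun w => _) = \sum_(i < n) (h \o Z i)); last first.
  by apply/funext => w; rewrite fct_sumE.
by rewrite rpred_sum ?lee1n// => i _; exact: ZL2.
Qed.

Let cov_sum n (Y : Omega -> R) : Y \in Lfun P 2%:E ->
  covariance P (fun w => \sum_(i < n) h (Z i w)) Y =
  (\sum_(i < n) covariance P (h \o Z i) Y)%E.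
Proof.
move=> YL2; have fP : P setT \is a fin_num by exact: fin_num_measure.
elim: n => [|n ihn].
  rewrite big_ord0 (_ : (fun w => _) = cst 0) ?covariance_cst_l//.
  by apply/funext => w; rewrite big_ord0.
rewrite big_ord_recr/= -ihn -covarianceDl//.
- by congr covariance; apply/funext => w /=; rewrite big_ord_recr.
Qed.

Lemma scaled_varianceE n : (0 < n)%N -> scaled_variance Z h n =
  ((2 * (\sum_(m < n.+1) \sum_(k < m) chain_cov k) - n%:R * chain_cov 0%N) / n%:R)%:E.
Proof.
move=> n0; rewrite /scaled_variance.
have -> : (fun w => n%:R^-1 * \sum_(i < n) h (Z i w)) =
    n%:R^-1 \o* (fun w => \sum_(i < n) h (Z i w)).
  by apply/funext => w; rewrite /= mulrC.
rewrite varianceZ; last exact: sumL2.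
rewrite /variance cov_sum; last exact: sumL2.
under eq_bigr do rewrite covarianceC cov_sum//.
pose g i j := inner P (h \o Z i) (h \o Z j) - (\int[mu]_x h x) ^+ 2.
have gC i j : g i j = g j i by rewrite /g innerC.
have ga i k : g i (i + k)%N = chain_cov k by rewrite /g chain_inner_shift.
rewrite -(sum_toeplitz n gC ga).
rewrite (_ : (\sum_(i < n) _)%E = (\sum_(i < n) \sum_(j < n) g i j)%:E); last first.
  rewrite -sumEFin; apply: eq_bigr => i _; rewrite -sumEFin; apply: eq_bigr => j _.
  by rewrite cov_chain gC.
rewrite -!EFinM; congr EFin; field.
by rewrite pnatr_eq0 -lt0n.
Qed.

(** The test inequality is asked for truncations of [h] only, so that a special form of [h], such as
    independence of the noise, remains usable. Its constant, [K] times the variance of the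
    truncation, tends to [K * chain_cov 0] along with the paired sums. *)
Lemma asymptotic_variance_le : cvgn (scaled_variance Z h) /\
  forall K : R, 0 <= K ->
    (forall f g, bounded_measurable f -> bounded_measurable g ->
      (exists n, f = trunc n h) ->
      inner mu (centered f) g ^+ 2 <=
        K * inner mu (centered f) (centered f) *
        (inner mu g g - inner mu g (markov_op Q g))) ->
    (asymptotic_variance Z h <=
      ((2 * K - 1) * (\int[mu]_x (h x * h x) - (\int[mu]_x h x) ^+ 2))%:E)%E.
Proof.
have [cv lv] := toeplitz_mean_limit chain_cov_norm_le paired_sum_chain_cov_nd scaled_varianceE.
split=> // K K0 HK.
have c0E : chain_cov 0%N = \int[mu]_x (h x * h x) - (\int[mu]_x h x) ^+ 2.
  rewrite /chain_cov; congr (_ - _).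
  have := @cvg_inner 0%N 0%N; under eq_cvg do rewrite -{2}(addn0 0%N) (chain_autocov 0 0 (bt _)).
  move=> /cvg_lim <-//; apply: cvg_lim => //.
  exact: (cvg_Rintegral_trunc (u := h) (v := h)).
rewrite -c0E mulrBl mul1r -mulrA; apply: lv => m.
have Kc : (fun n => K * autocov mu Q (centered (trunc n h)) 0%N) @ \oo -->
    K * chain_cov 0%N.
  by apply: cvgMr; exact: cvg_autocov_trunc.
apply: (ler_cvg_to (@cvg_paired_sum_trunc m) Kc); apply: nearW => n.
have bc := bounded_centered (bt n).
apply: paired_sum_le => //; first by rewrite mulr_ge0// inner_ge0.
by move=> g bg; apply: HK => //; exists n.
Qed.

End square_integrable.

End stationary_chain.

(** * Metropolis kernels *)

Section density_dirac.
Context d (T : measurableType d) (R : realType).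
Variables (m K : {measure set T -> \bar R}) (w : T -> R) (c : \bar R) (x : T).
Hypothesis mw : measurable_fun setT w.
Hypothesis w0 : forall y, (0 <= w y)%R.
Hypothesis c0 : 0 <= c.
Hypothesis cfin : c \is a fin_num.
Hypothesis KE : forall A, measurable A ->
  K A = \int[m]_(y in A) (w y)%:E + c * \d_x A.

Let mwf (f : T -> \bar R) : measurable_fun setT f ->
  measurable_fun setT (fun y => (w y)%:E * f y).
Proof. by move=> mf; apply: emeasurable_funM => //; exact/measurable_EFinP. Qed.

(** The common form of a Metropolis kernel (accepted moves plus the mass left at [x]) and, with
    [c = 0], of a measure given by a density. [KE] is the case of indicators; [cfin] lets [c] pass
    through monotone limits. *)
Lemma ge0_integral_density_dirac f : measurable_fun setT f ->
  (forall y, 0 <= f y) ->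
  \int[K]_y f y = \int[m]_y ((w y)%:E * f y) + c * f x.
Proof.
have wf0 (f' : T -> \bar R) : (forall y, 0 <= f' y) -> forall y, 0 <= (w y)%:E * f' y.
  by move=> f0 y; rewrite mule_ge0 ?lee_fin.
move: f; apply: ge0_measurable_ind.
- move=> A mA; rewrite integral_indic// setIT KE//; congr (_ + _).
  rewrite integral_mkcond; apply: eq_integral => y _.
  by rewrite patchE /= indicE; case: ifPn => _; rewrite ?mule1 ?mule0.
- move=> r f g r0 mf mg f0 g0 Pf Pg.
  have mrf : measurable_fun setT (fun y => r%:E * f y) by exact: measurable_funeM.
  have rf0 y : 0 <= r%:E * f y by rewrite mule_ge0.
  rewrite ge0_integralD// ge0_integralZl// Pf Pg.
  under [in RHS]eq_integral do rewrite ge0_muleDr// muleCA.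
  rewrite ge0_integralD//; last 4 first.
  + by move=> y _; rewrite mule_ge0// wf0.
  + by apply: measurable_funeM; exact: mwf.
  + by move=> y _; rewrite wf0.
  + exact: mwf.
  rewrite ge0_integralZl//; last 2 first.
  + exact: mwf.
  + by move=> y _; rewrite wf0.
  have I0 : 0 <= \int[m]_y ((w y)%:E * f y) by apply: integral_ge0 => y _; exact: wf0.
  rewrite [r%:E * (_ + _)]ge0_muleDr ?mule_ge0// [c * (_ + _)]ge0_muleDr//.
  by rewrite [in RHS]muleCA addeACA.
- move=> h mh h0 ndh Ph.
  have limE y : limn (h ^~ y) * (w y)%:E = limn (fun n => (w y)%:E * h n y).
    apply/esym/cvg_lim => //; rewrite muleC; apply: cvgeZl => //.
    by apply: ereal_nondecreasing_is_cvgn; exact: ndh.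
  rewrite monotone_convergence//.
  under [in RHS]eq_integral do rewrite muleC limE.
  rewrite [in RHS]monotone_convergence//; last 3 first.
  + by move=> n; exact: mwf.
  + by move=> n y _; exact: wf0.
  + by move=> y _ i j ij; rewrite lee_pmul// ?lee_fin//; exact: ndh.
  under eq_fun do rewrite Ph.
  apply/cvg_lim => //.
  apply: cvgeD.
  + rewrite ge0_adde_def// inE.
      apply: lime_ge; last by apply: nearW => n; apply: integral_ge0 => y _; exact: wf0.
      apply: ereal_nondecreasing_is_cvgn => i j ij; apply: ge0_le_integral => //.
      * by move=> y _; exact: wf0.
      * exact: mwf.
      * exact: mwf.
      * by move=> y _; rewrite lee_pmul// ?lee_fin//; exact: ndh.
    rewrite mule_ge0//; apply: lime_ge; last exact: nearW.
    by apply: ereal_nondecreasing_is_cvgn; exact: ndh.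
  + apply: ereal_nondecreasing_is_cvgn => i j ij; apply: ge0_le_integral => //.
    * by move=> y _; exact: wf0.
    * exact: mwf.
    * exact: mwf.
    * by move=> y _; rewrite lee_pmul// ?lee_fin//; exact: ndh.
  + by apply: cvgeZl => //; apply: ereal_nondecreasing_is_cvgn; exact: ndh.
Qed.

End density_dirac.

Section metropolis_integrals.
Context d (T : measurableType d) (R : realType).
Variables (m : {sigma_finite_measure set T -> \bar R}) (S : set T).
Hypothesis mS : measurable S.
Variable p : density m S.

Definition restricted_density : T -> R := ((p : T -> R) \_ S)%R.
Local Notation pS := restricted_density.

Lemma measurable_restricted_density : measurable_fun setT pS.
Proof. by apply/(measurable_restrictT _ _).1 => //; exact: density_measurable. Qed.

Lemma restricted_density_ge0 x : (0 <= pS x)%R.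
Proof. by rewrite /pS patchE; case: ifPn => // /set_mem Sx; exact: density_ge0. Qed.

Lemma ge0_integral_density_prob f : measurable_fun setT f ->
  (forall y, 0 <= f y) ->
  \int[density_prob mS p]_y f y = \int[m]_y ((pS y)%:E * f y).
Proof.
move=> mf f0; rewrite (@ge0_integral_density_dirac _ _ _ m (density_prob mS p) pS 0 point)//.
- by rewrite mul0e adde0.
- exact: measurable_restricted_density.
- exact: restricted_density_ge0.
- move=> A mA; rewrite mul0e adde0 /= /density_prob integral_mkcondr.
  apply: eq_integral => y _; rewrite /pS !patchE.
  by case: ifP.
Qed.

Variables (q : proposal m S) (rho : T -> T -> R).
Hypothesis mrho : measurable_fun (S `*` S) (fun z : T * T => rho z.1 z.2).
Hypothesis rho0 : forall x y, S x -> S y -> (0 <= rho x y)%R.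

Local Notation move := (move_density q rho).
Local Notation Q := (metropolis_kernel mS q mrho rho0).

Lemma move_density_ge0 z : (0 <= move z)%R.
Proof.
rewrite /move_density patchE; case: ifPn => // /set_mem [/= S1 S2].
by rewrite mulr_ge0 ?proposal_ge0// le_min ler01 rho0.
Qed.

Lemma measurable_move_density : measurable_fun setT move.
Proof.
apply/(measurable_restrictT _ _).1; first exact: measurableX.
apply: measurable_funM; last exact: proposal_measurable.
exact: measurable_minr.
Qed.

Lemma measurable_move_density1 x : measurable_fun setT (fun y => move (x, y)).
Proof. exact: (measurableT_comp measurable_move_density (pair1_measurable x)). Qed.

Lemma integral_move_density_le1 x : \int[m]_y (move (x, y))%:E <= 1.
Proof.
have [Sx|Sx] := pselect (S x); last first.
  rewrite integral0_eq// => y _; rewrite /move_density patchE ifN//.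
  by apply/negP => /set_mem [].
rewrite -(proposal_int q Sx) integral_mkcond; apply: ge0_le_integral => //.
- by move=> y _; rewrite lee_fin move_density_ge0.
- by apply/measurable_EFinP; exact: measurable_move_density1.
- apply/(measurable_restrictT _ _).1 => //; apply/measurable_EFinP.
  rewrite (_ : q x = (fun z => q z.1 z.2) \o (pair x))//.
  apply: (@measurable_comp _ _ _ _ _ _ (S `*` S)) => //.
  + exact: measurableX.
  + by move=> _ [y Sy <-]; split.
  + exact: proposal_measurable.
  + exact/measurable_funTS/pair1_measurable.
- move=> y _; rewrite /move_density !patchE in_setX/= (mem_set Sx)/=.
  by case: ifPn => // /set_mem Sy; rewrite lee_fin ler_piMl ?proposal_ge0// ge_min lexx.
Qed.

Let stay x : \bar R := 1 - \int[m]_y (move (x, y))%:E.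

Let move_fin x : \int[m]_y (move (x, y))%:E \is a fin_num.
Proof.
rewrite ge0_fin_numE; last first.
  by apply: integral_ge0 => y _; rewrite lee_fin move_density_ge0.
by rewrite (le_lt_trans (integral_move_density_le1 x))// ltry.
Qed.

Let stay_ge0 x : 0 <= stay x.
Proof. by rewrite sube_ge0 ?integral_move_density_le1 ?move_fin. Qed.

Let stay_fin x : stay x \is a fin_num.
Proof. by rewrite fin_numB move_fin. Qed.

Lemma ge0_integral_metropolis x f : measurable_fun setT f ->
  (forall y, 0 <= f y) ->
  \int[Q x]_y f y = \int[m]_y ((move (x, y))%:E * f y) + stay x * f x.
Proof.
move=> mf f0; apply: ge0_integral_density_dirac => //.
- exact: measurable_move_density1.
- by move=> y; exact: move_density_ge0.
Qed.

(** The density of accepted moves in mu(dx) Q(x, dy); its symmetry is detailed balance. *)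
Definition flow_density (z : T * T) : R := (pS z.1 * move z)%R.

Lemma flow_density_ge0 z : (0 <= flow_density z)%R.
Proof. by rewrite mulr_ge0 ?restricted_density_ge0 ?move_density_ge0. Qed.

Lemma measurable_flow_density : measurable_fun setT flow_density.
Proof.
apply: measurable_funM; last exact: measurable_move_density.
by apply: measurableT_comp => //; exact: measurable_restricted_density.
Qed.

(** Rejected moves drop out, as the increment of [f] vanishes there. *)
Lemma dirichlet_metropolis (f : T -> R) : measurable_fun setT f ->
  dirichlet (density_prob mS p) Q f =
  2^-1%:E * \int[m]_x \int[m]_y (flow_density (x, y) * (f y - f x) ^+ 2)%:E.
Proof.
move=> mf; rewrite /dirichlet; congr (_ * _).
have mff x : measurable_fun setT (fun y => ((f y - f x) ^+ 2)%:E).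
  by apply/measurable_EFinP/measurable_funX; exact: measurable_funB.
have mm : measurable_fun setT (fun x => \int[m]_y (move (x, y) * (f y - f x) ^+ 2)%:E).
  apply: (@measurable_fun_fubini_tonelli_F _ _ _ _ _ m
    (fun z => (move z * (f z.2 - f z.1) ^+ 2)%:E)).
    apply/measurable_EFinP/measurable_funM; first exact: measurable_move_density.
    by apply: measurable_funX; apply: measurable_funB; exact: measurableT_comp.
  by move=> z; rewrite lee_fin mulr_ge0 ?move_density_ge0 ?sqr_ge0.
have E x : \int[Q x]_y ((f y - f x) ^+ 2)%:E =
    \int[m]_y (move (x, y) * (f y - f x) ^+ 2)%:E.
  rewrite ge0_integral_metropolis//; last by move=> y; rewrite lee_fin sqr_ge0.
  by rewrite subrr expr0n/= mule0 adde0.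
under eq_integral do rewrite E.
rewrite ge0_integral_density_prob//; last first.
  move=> x; apply: integral_ge0 => y _.
  by rewrite lee_fin mulr_ge0 ?move_density_ge0 ?sqr_ge0.
apply: eq_integral => x _; rewrite -ge0_integralZl//.
- by apply: eq_integral => y _; rewrite -EFinM mulrA.
- apply/measurable_EFinP/measurable_funM; first exact: measurable_move_density1.
  by apply: measurable_funX; exact: measurable_funB.
- by move=> y _; rewrite lee_fin mulr_ge0 ?move_density_ge0 ?sqr_ge0.
- by rewrite lee_fin restricted_density_ge0.
Qed.

(** Rejected moves sit on the diagonal and contribute an integral over the intersection of [A] and
    [B], symmetric by itself; for accepted moves Tonelli exchanges the variables. *)
Lemma metropolis_reversible :
  (forall x y, flow_density (x, y) = flow_density (y, x)) ->
  reversible (density_prob mS p) Q.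
Proof.
move=> flowC A B mA mB.
have QE C x : measurable C ->
    Q x C = \int[m]_y ((move (x, y))%:E * (\1_C y)%:E) + stay x * (\1_C x)%:E.
  move=> mC; rewrite -(@ge0_integral_metropolis x (fun y => (\1_C y)%:E)).
  - by rewrite integral_indic// setIT.
  - exact/measurable_EFinP/measurable_indic.
  - by move=> y; rewrite lee_fin.
pose g C D (z : T * T) : \bar R := (flow_density z * (\1_C z.1 * \1_D z.2))%:E.
have mg C D : measurable C -> measurable D -> measurable_fun setT (g C D).
  move=> mC mD; apply/measurable_EFinP/measurable_funM; first exact: measurable_flow_density.
  by apply: measurable_funM; apply: measurableT_comp => //; exact: measurable_indic.
have g0 C D z : 0 <= g C D z.
  by rewrite lee_fin mulr_ge0 ?flow_density_ge0// mulr_ge0.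
pose s x := (pS x)%:E * stay x.
have ms : measurable_fun setT s.
  apply: emeasurable_funM.
    by apply/measurable_EFinP; exact: measurable_restricted_density.
  apply: emeasurable_funB => //.
  apply: (@measurable_fun_fubini_tonelli_F _ _ _ _ _ m (EFin \o move)).
    by apply/measurable_EFinP; exact: measurable_move_density.
  by move=> z; rewrite lee_fin move_density_ge0.
have s0 x : 0 <= s x by rewrite mule_ge0 ?lee_fin ?restricted_density_ge0.
have E C D : measurable C -> measurable D ->
    \int[density_prob mS p]_(x in C) Q x D =
    \int[m]_x \int[m]_y g C D (x, y) + \int[m]_x (s x * (\1_(C `&` D) x)%:E).
  move=> mC mD; rewrite integral_mkcond ge0_integral_density_prob; last 2 first.
  - apply/(measurable_restrictT _ _).1 => //; apply: measurable_funTS.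
    exact: measurable_kernel.
  - by move=> y; rewrite patchE; case: ifP.
  rewrite -ge0_integralD//; last 4 first.
  - by move=> x _; apply: integral_ge0.
  - by apply: (@measurable_fun_fubini_tonelli_F _ _ _ _ _ m (g C D)) => //; exact: mg.
  - by move=> x _; rewrite mule_ge0 ?lee_fin.
  - by apply: emeasurable_funM => //; apply/measurable_EFinP/measurable_indic; exact: measurableI.
  apply: eq_integral => x _; rewrite patchE indicI /=.
  have [xC|xC] := boolP (x \in C); last first.
    rewrite !indicE (negbTE xC) mul0r !mule0 adde0.
    by rewrite integral0_eq// => y _; rewrite /g indicE /= (negbTE xC) mul0r mulr0.
  rewrite QE// ge0_muleDr ?mule_ge0 ?lee_fin//; last first.
    by apply: integral_ge0 => y _; rewrite mule_ge0 ?lee_fin ?move_density_ge0.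
  have C1 : \1_C x = 1%R :> R by rewrite indicE xC.
  rewrite muleA -/(s x) C1 mul1r; congr (_ + _).
  rewrite -ge0_integralZl//.
  - by apply: eq_integral => y _; rewrite /g /= C1 mul1r -!EFinM mulrA.
  - apply: emeasurable_funM; first by apply/measurable_EFinP; exact: measurable_move_density1.
    exact/measurable_EFinP/measurable_indic.
  - by move=> y _; rewrite mule_ge0 ?lee_fin ?move_density_ge0.
  - by rewrite lee_fin restricted_density_ge0.
apply: (etrans (E A B mA mB)); apply: (etrans _ (esym (E B A mB mA))).
apply: (congr2 (fun u v : \bar R => u + v)); last by rewrite setIC.
transitivity (\int[m]_y \int[m]_x g A B (x, y)).
  exact: (@fubini_tonelli _ _ _ _ _ m m (g A B) (mg _ _ mA mB) (g0 A B)).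
apply: eq_integral => x _; apply: eq_integral => y _.
by rewrite /g/= flowC [(\1_A _ * _)%R]mulrC.
Qed.

End metropolis_integrals.

Section product_double_integral.
Context d1 d2 (T1 : measurableType d1) (T2 : measurableType d2) (R : realType).
Variables (m1 : {sigma_finite_measure set T1 -> \bar R})
  (m2 : {sigma_finite_measure set T2 -> \bar R}).
Variables (s : T1 * T1 -> R) (k : T2 * T2 -> R) (g : T1 * T2 -> R).
Hypotheses (ms : measurable_fun setT s) (s0 : forall z, (0 <= s z)%R).
Hypotheses (mk : measurable_fun setT k) (k0 : forall z, (0 <= k z)%R).
Hypothesis mg : measurable_fun setT g.

Let H (x : T1) (w : T2) (y : T1) (v : T2) : \bar R :=
  (s (x, y) * k (w, v) * (g (y, v) - g (x, w)) ^+ 2)%:E.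

Let H0 x w y v : 0 <= H x w y v.
Proof. by rewrite /H lee_fin mulr_ge0 ?sqr_ge0// mulr_ge0. Qed.

Let mH d (T : measurableType d) (a b : T -> T1) (a' b' : T -> T2) :
  measurable_fun setT a -> measurable_fun setT b ->
  measurable_fun setT a' -> measurable_fun setT b' ->
  measurable_fun setT (fun z => H (a z) (a' z) (b z) (b' z)).
Proof.
move=> ma mb ma' mb'; apply/measurable_EFinP; apply: measurable_funM.
  apply: measurable_funM.
    by apply: (measurableT_comp ms); exact: measurable_fun_pair.
  by apply: (measurableT_comp mk); exact: measurable_fun_pair.
apply: measurable_funX; apply: measurable_funB.
  by apply: (measurableT_comp mg); exact: measurable_fun_pair.
by apply: (measurableT_comp mg); exact: measurable_fun_pair.
Qed.

Lemma integral_sigma_finite_prod (f : T1 * T2 -> \bar R) :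
  measurable_fun setT f -> (forall z, 0 <= f z) ->
  \int[sigma_finite_prod m1 m2]_z f z = \int[m1]_x \int[m2]_w f (x, w).
Proof. by move=> mf f0; exact: (fubini_tonelli1 (m1 := m1) (m2 := m2) f mf f0). Qed.

(** Tonelli moves the two states outside and the two noise variables inside, so that an inequality
    for fixed [(x, y)] can be used. *)
Lemma double_integral_sigma_finite_prod :
  \int[sigma_finite_prod m1 m2]_z \int[sigma_finite_prod m1 m2]_z'
    (s (z.1, z'.1) * k (z.2, z'.2) * (g z' - g z) ^+ 2)%:E =
  \int[m1]_x \int[m1]_y ((s (x, y))%:E *
    \int[m2]_w \int[m2]_v (k (w, v) * (g (y, v) - g (x, w)) ^+ 2)%:E).
Proof.
have mV (x : T1) : measurable_fun setT
    (fun z : T2 * T1 => \int[m2]_v H x z.1 z.2 v).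
  apply: (@measurable_fun_fubini_tonelli_F _ _ _ _ _ m2
    (fun u : (T2 * T1) * T2 => H x u.1.1 u.1.2 u.2)) => //.
  apply: mH => //; exact: measurableT_comp.
transitivity (\int[m1]_x \int[m2]_w \int[m1]_y \int[m2]_v H x w y v).
  transitivity (\int[sigma_finite_prod m1 m2]_z
      \int[m1]_y \int[m2]_v H z.1 z.2 y v).
    apply: eq_integral => -[x w] _.
    transitivity (\int[sigma_finite_prod m1 m2]_z' H x w z'.1 z'.2).
      by apply: eq_integral => -[y v].
    by rewrite integral_sigma_finite_prod//; exact: mH.
  rewrite integral_sigma_finite_prod//.
  - apply: (@measurable_fun_fubini_tonelli_F _ _ _ _ _ m1
      (fun u : (T1 * T2) * T1 => \int[m2]_v H u.1.1 u.1.2 u.2 v)).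
      apply: (@measurable_fun_fubini_tonelli_F _ _ _ _ _ m2
        (fun u : ((T1 * T2) * T1) * T2 => H u.1.1.1 u.1.1.2 u.1.2 u.2)) => //.
      by apply: mH; do ?[exact: measurable_snd|exact: measurable_fst|apply: measurableT_comp => //].
    by move=> z; exact: integral_ge0.
  - by move=> z; apply: integral_ge0 => y _; exact: integral_ge0.
apply: eq_integral => x _.
transitivity (\int[m1]_y \int[m2]_w \int[m2]_v H x w y v).
  apply: (@fubini_tonelli _ _ _ _ _ m2 m1 (fun z => \int[m2]_v H x z.1 z.2 v)) => //.
  by move=> z; exact: integral_ge0.
apply: eq_integral => y _.
have kg0 w v : 0 <= (k (w, v) * (g (y, v) - g (x, w)) ^+ 2)%:E.
  by rewrite lee_fin mulr_ge0 ?sqr_ge0.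
have mkg : measurable_fun setT
    (fun z : T2 * T2 => (k z * (g (y, z.2) - g (x, z.1)) ^+ 2)%:E).
  apply/measurable_EFinP/measurable_funM => //; apply: measurable_funX.
  by apply: measurable_funB; apply: (measurableT_comp mg); exact: measurable_fun_pair.
rewrite -ge0_integralZl//.
- apply: eq_integral => w _; rewrite -ge0_integralZl//.
  + by apply: eq_integral => v _; rewrite -EFinM mulrA.
  + exact: (measurableT_comp mkg (pair1_measurable w)).
  + by rewrite lee_fin.
- apply: (@measurable_fun_fubini_tonelli_F _ _ _ _ _ m2
    (fun z : T2 * T2 => (k z * (g (y, z.2) - g (x, z.1)) ^+ 2)%:E)) => //.
  by move=> [w v]; exact: kg0.
- by move=> w _; exact: integral_ge0.
- by rewrite lee_fin.
Qed.

End product_double_integral.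

(** * Averaging over the noise *)

Section noise_cauchy_schwarz.
Context (R : realType).
Local Notation RR := (measurableTypeR R).
Local Notation leb := (@lebesgue_measure R).
Variables (W : set RR) (mW : measurable W) (W0 : forall w : R, W w -> (0 <= w)%R).
Variable qw : density leb W.
Hypothesis qw_mean : \int[leb]_(w in W) (w * qw w)%:E = 1.

Definition nu_density : density leb W :=
  Density (measurable_nu qw) (nu_ge0 W0 qw) qw_mean.

Definition nu_prob : probability RR R := density_prob mW nu_density.

Local Notation qW := (restricted_density qw).
Local Notation nuW := (restricted_density nu_density).

Lemma nuWE w : nuW w = (w * qW w)%R.
Proof.
rewrite /restricted_density !patchE; case: ifP => // _.
by rewrite /= mulr0.
Qed.

Let qW0 w : (0 <= qW w)%R. Proof. exact: restricted_density_ge0. Qed.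
Let nuW0 w : (0 <= nuW w)%R. Proof. exact: restricted_density_ge0. Qed.
Let mqW : measurable_fun setT qW. Proof. exact: measurable_restricted_density. Qed.
Let mnuW : measurable_fun setT nuW. Proof. exact: measurable_restricted_density. Qed.

Let qW_W w : qW w != 0%R -> (0 <= w)%R.
Proof.
rewrite /restricted_density patchE; case: ifP => [/set_mem /W0//|].
by rewrite /= eqxx.
Qed.

Definition min_weight (z : RR * RR) : R := (qW z.1 * qW z.2 * Num.min (z.1 : R) (z.2 : R))%R.

(** Where the minimum is negative, one of the points lies outside [W] and its factor [qW]
    vanishes. *)
Lemma min_weight_ge0 z : (0 <= min_weight z)%R.
Proof.
rewrite /min_weight; have [->|q1] := eqVneq (qW z.1) 0%R; first by rewrite !mul0r.
have [->|q2] := eqVneq (qW z.2) 0%R; first by rewrite mulr0 mul0r.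
by rewrite mulr_ge0 ?mulr_ge0// le_min !qW_W.
Qed.

Lemma measurable_min_weight : measurable_fun setT min_weight.
Proof.
apply: measurable_funM.
  by apply: measurable_funM; apply: measurableT_comp.
by apply: measurable_minr; [exact: measurable_fst|exact: measurable_snd].
Qed.

Let max_weight (z : RR * RR) : R :=
  (qW z.1 * qW z.2 * z.1 * z.2 * Num.max (z.1 : R) (z.2 : R))%R.

Let max_weight_ge0 z : (0 <= max_weight z)%R.
Proof.
rewrite /max_weight; have [->|q1] := eqVneq (qW z.1) 0%R; first by rewrite !mul0r.
have [->|q2] := eqVneq (qW z.2) 0%R; first by rewrite mulr0 !mul0r.
have [w1 w2] := (qW_W q1, qW_W q2).
by apply: mulr_ge0; [rewrite !mulr_ge0|rewrite le_max w1].
Qed.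

Let measurable_max_weight : measurable_fun setT max_weight.
Proof.
apply: measurable_funM.
  do 2 (apply: measurable_funM; last by [exact: measurable_fst|exact: measurable_snd]).
  by apply: measurable_funM; apply: measurableT_comp.
by apply: measurable_maxr; [exact: measurable_fst|exact: measurable_snd].
Qed.

Lemma R_SE : R_S qw = \int[leb]_w \int[leb]_v (max_weight (w, v))%:E.
Proof.
rewrite /R_S integral_mkcond -(fubini_tonelli1 (m1 := leb) (m2 := leb) (EFin \o max_weight)).
- apply: eq_integral => z _; rewrite /max_weight /restricted_density /= !patchE in_setX.
  by case: (z.1 \in W); case: (z.2 \in W) => //=; rewrite ?mul0r ?mulr0 ?mul0r.
- exact/measurable_EFinP.
- by move=> z; rewrite /= lee_fin.
Qed.

Lemma R_S_ge0 : 0 <= R_S qw.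
Proof.
by rewrite R_SE; apply: integral_ge0 => w _; apply: integral_ge0 => v _; rewrite lee_fin.
Qed.

Variables u v : RR -> R.
Hypotheses (bu : bounded_measurable u) (bv : bounded_measurable v).

Let J := \int[leb]_w \int[leb]_w' (min_weight (w, w') * (v w' - u w) ^+ 2)%:E.

Let sq_ge0 w w' : 0 <= (min_weight (w, w') * (v w' - u w) ^+ 2)%:E.
Proof. by rewrite lee_fin mulr_ge0 ?min_weight_ge0 ?sqr_ge0. Qed.

Let msq : measurable_fun setT
  (fun z : RR * RR => (min_weight z * (v z.2 - u z.1) ^+ 2)%:E).
Proof.
apply/measurable_EFinP/measurable_funM; first exact: measurable_min_weight.
apply: measurable_funX; apply: measurable_funB; apply: measurableT_comp => //.
  exact: bv.1.
exact: bu.1.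
Qed.

Let msq1 w : measurable_fun setT
  (fun w' => (min_weight (w, w') * (v w' - u w) ^+ 2)%:E).
Proof. exact: (measurableT_comp msq (pair1_measurable w)). Qed.

Let mJ : measurable_fun setT
  (fun w => \int[leb]_w' (min_weight (w, w') * (v w' - u w) ^+ 2)%:E).
Proof.
apply: (@measurable_fun_fubini_tonelli_F _ _ _ _ _ leb
  (fun z : RR * RR => (min_weight z * (v z.2 - u z.1) ^+ 2)%:E)) => //.
by move=> [w w']; exact: sq_ge0.
Qed.

Let J_ge0 : 0 <= J.
Proof. by apply: integral_ge0 => w _; exact: integral_ge0. Qed.

(** As min(w, w') <= w, the weight is at most [nuW w * qW w'], a product of two probability
    densities, so J is at most (M + N)^2. Finiteness lets [J] enter a real inequality. *)
Let J_fin : J < +oo.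
Proof.
have [_ [M uM]] := bu; have [_ [N vN]] := bv.
pose C := ((M + N) ^+ 2)%R; have C0 : (0 <= C)%R by exact: sqr_ge0.
have qint : \int[leb]_w' (qW w')%:E = 1.
  transitivity (\int[density_prob mW qw]_w' (cst 1 w')).
    rewrite ge0_integral_density_prob//.
    by apply: eq_integral => w _; rewrite mule1.
  by rewrite integral_cst// mul1e; exact: probability_setT.
have nint : \int[leb]_w' (nuW w')%:E = 1.
  transitivity (\int[density_prob mW nu_density]_w' (cst 1 w')).
    rewrite ge0_integral_density_prob//.
    by apply: eq_integral => w _; rewrite mule1.
  by rewrite integral_cst// mul1e; exact: probability_setT.
have mqWE : measurable_fun setT (EFin \o qW) by exact/measurable_EFinP.
have mnuWE : measurable_fun setT (EFin \o nuW) by exact/measurable_EFinP.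
apply: (@le_lt_trans _ _ (\int[leb]_w ((C)%:E * (nuW w)%:E))); last first.
  by rewrite ge0_integralZl// ?nint ?mule1 ?ltry// => w _; rewrite lee_fin.
apply: ge0_le_integral => //.
- by move=> w _; exact: integral_ge0.
- exact: measurable_funeM.
move=> w _; rewrite -[leRHS]mule1 -qint -ge0_integralZl//; last 2 first.
- by move=> w' _; rewrite lee_fin.
- by rewrite mule_ge0 ?lee_fin.
apply: ge0_le_integral => //.
- exact: measurable_funeM.
move=> w' _; rewrite -!EFinM lee_fin mulrC -mulrA; apply: ler_pM.
- exact: sqr_ge0.
- exact: min_weight_ge0.
- have M0 : (0 <= M)%R := le_trans (normr_ge0 _) (uM point).
  have N0 : (0 <= N)%R := le_trans (normr_ge0 _) (vN point).
  rewrite -[leLHS]real_normK ?num_real// ler_pXn2r ?nnegrE ?addr_ge0//.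
  by rewrite (le_trans (ler_normB _ _))// addrC lerD.
- rewrite /min_weight/= nuWE [X in (_ <= X * _)%R]mulrC mulrAC.
  by apply: ler_wpM2r => //; apply: ler_wpM2l => //; rewrite ge_min lexx.
Qed.

(* For [t > 0], [2 w w' |D| <= t w w' max(w, w') + min(w, w') D^2 / t]
   because [w w' = max(w, w') min(w, w')]. *)
Lemma noise_cauchy_schwarz (r : R) : R_S qw = r%:E ->
  ((\int[nu_prob]_w' v w' - \int[nu_prob]_w u w) ^+ 2)%:E <= r%:E * J.
Proof.
move=> Rr; have r0 : (0 <= r)%R by rewrite -lee_fin -Rr R_S_ge0.
have Jf : J \is a fin_num by rewrite ge0_fin_numE.
rewrite -(fineK Jf) -EFinM lee_fin; apply: sqr_le_of_AMGM => //; first exact: fine_ge0.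
move=> t t0; rewrite -lee_fin EFinD !EFinM fineK// -Rr.
set a := (\int[nu_prob]_w' v w')%R.
(* The triangle inequality in each variable bounds twice the difference of the means by this double
   integral; what remains is pointwise in [(w, w')]. *)
apply: (@le_trans _ _ (\int[nu_prob]_w \int[nu_prob]_w' (2 * `|v w' - u w|)%:E)).
  have bvu w : bounded_measurable (fun w' => v w' - u w)%R.
    by apply: bounded_measurableB => //; exact: bounded_measurable_cst.
  have bn d (T : measurableType d) (f : T -> R) : bounded_measurable f ->
      bounded_measurable (fun x => `|f x|)%R.
    move=> [mf [M fM]]; split; first exact: measurableT_comp.
    by exists M => x; rewrite normr_id.
  have bau : bounded_measurable (fun w => a - u w)%R.
    by apply: bounded_measurableB => //; exact: bounded_measurable_cst.
  apply: (@le_trans _ _ (\int[nu_prob]_w (2 * `|a - u w|)%:E)).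
    rewrite -EFin_bounded_Rintegral; last by apply: bounded_measurableZ; exact: bn.
    rewrite bounded_RintegralZl; last exact: bn.
    rewrite -EFinM lee_fin ler_pM2l// -[X in (X - _)%R](bounded_Rintegral_cst nu_prob).
    rewrite -bounded_RintegralB//; last exact: bounded_measurable_cst.
    apply: le_normr_Rintegral => //; exact: bounded_integrable.
  apply: ge0_le_integral => //.
  - by apply/measurable_EFinP/measurable_funM => //; exact: (bn _ _ _ bau).1.
  - apply: (@measurable_fun_fubini_tonelli_F _ _ _ _ _ nu_prob
      (fun z : RR * RR => (2 * `|v z.2 - u z.1|)%:E)).
      apply/measurable_EFinP/measurable_funM => //; apply: measurableT_comp => //.
      apply: measurable_funB; apply: measurableT_comp => //; [exact: bv.1|exact: bu.1].
    by move=> z; rewrite lee_fin mulr_ge0.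
  move=> w _; rewrite -EFin_bounded_Rintegral; last by apply: bounded_measurableZ; exact: bn.
  rewrite lee_fin bounded_RintegralZl; last exact: bn.
  rewrite ler_pM2l// -[X in (_ - X)%R](bounded_Rintegral_cst nu_prob).
  rewrite -bounded_RintegralB//; last exact: bounded_measurable_cst.
  by apply: le_normr_Rintegral => //; exact: bounded_integrable.
have mabs : measurable_fun setT (fun z : RR * RR => (2 * `|v z.2 - u z.1|)%R).
  apply: measurable_funM => //; apply: measurableT_comp => //.
  apply: measurable_funB; apply: measurableT_comp => //; [exact: bv.1|exact: bu.1].
have mabs1 w : measurable_fun setT (fun w' => (2 * `|v w' - u w|)%:E).
  by apply/measurable_EFinP; exact: (measurableT_comp mabs (pair1_measurable w)).
rewrite ge0_integral_density_prob; last 2 first.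
- apply: (@measurable_fun_fubini_tonelli_F _ _ _ _ _ nu_prob
    (fun z : RR * RR => (2 * `|v z.2 - u z.1|)%:E)).
    exact/measurable_EFinP.
  by move=> z; rewrite lee_fin mulr_ge0.
- by move=> w; apply: integral_ge0 => w' _; rewrite lee_fin mulr_ge0.
have mmax1 w : measurable_fun setT (fun w' => (max_weight (w, w'))%:E).
  by apply/measurable_EFinP; exact: (measurableT_comp measurable_max_weight (pair1_measurable w)).
have mmax : measurable_fun setT (fun w => \int[leb]_w' (max_weight (w, w'))%:E).
  apply: (@measurable_fun_fubini_tonelli_F _ _ _ _ _ leb (EFin \o max_weight)).
    exact/measurable_EFinP.
  by move=> z; rewrite lee_fin.
have max0 w : 0 <= \int[leb]_w' (max_weight (w, w'))%:E.
  by apply: integral_ge0 => w' _; rewrite lee_fin.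
have sq0 w : 0 <= \int[leb]_w' (min_weight (w, w') * (v w' - u w) ^+ 2)%:E.
  exact: integral_ge0.
have ti0 : (0 <= t^-1)%R by rewrite invr_ge0 ltW.
rewrite R_SE -ge0_integralZl//; last by rewrite lee_fin ltW.
rewrite -[X in _ <= _ + X]ge0_integralZl//.
rewrite -ge0_integralD//; last 4 first.
- by move=> w _; rewrite mule_ge0 ?lee_fin// ltW.
- exact: measurable_funeM.
- by move=> w _; rewrite mule_ge0 ?lee_fin.
- exact: measurable_funeM.
apply: ge0_le_integral => //.
- by move=> w _; rewrite mule_ge0 ?lee_fin// integral_ge0// => w' _; rewrite lee_fin mulr_ge0.
- apply: emeasurable_funM; first exact/measurable_EFinP.
  apply: (@measurable_fun_fubini_tonelli_F _ _ _ _ _ nu_prob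
    (fun z : RR * RR => (2 * `|v z.2 - u z.1|)%:E)).
    exact/measurable_EFinP.
  by move=> z; rewrite lee_fin mulr_ge0.
- by apply: emeasurable_funD; exact: measurable_funeM.
move=> w _; rewrite ge0_integral_density_prob//.
rewrite -!ge0_integralZl//; try by
  [rewrite lee_fin|rewrite lee_fin ltW|apply: emeasurable_funM => //; exact/measurable_EFinP
  |move=> w' _; rewrite lee_fin|move=> w' _; rewrite mule_ge0 ?lee_fin// mulr_ge0].
rewrite -ge0_integralD//; try by
  [exact: measurable_funeM|move=> w' _; rewrite mule_ge0 ?lee_fin// ltW
  |move=> w' _; apply: mule_ge0; [rewrite lee_fin|exact: sq_ge0]].
apply: ge0_le_integral => //.
- by move=> w' _; rewrite !mule_ge0 ?lee_fin// mulr_ge0.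
- apply: measurable_funeM; apply: emeasurable_funM => //; exact/measurable_EFinP.
- by apply: emeasurable_funD; exact: measurable_funeM.
move=> w' _; rewrite -!EFinM -EFinD lee_fin !nuWE /max_weight /min_weight/=.
have [->|q1] := eqVneq (qW w) 0%R; first by rewrite !(mul0r, mulr0) addr0.
have [->|q2] := eqVneq (qW w') 0%R; first by rewrite !(mul0r, mulr0) addr0.
have [w0 w0'] := (qW_W q1, qW_W q2).
set D := `|_|%R; have -> : ((v w' - u w) ^+ 2 = D ^+ 2)%R.
  by rewrite /D real_normK ?num_real.
have key : (2 * (w * w') * D <= t * (w * w' * Num.max w w') + t^-1 * (Num.min w w' * D ^+ 2))%R.
  have -> : (w * w' = Num.max w w' * Num.min w w')%R.
    by case: (leP w w') => _ //; rewrite mulrC.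
  set M := Num.max _ _; set n := Num.min _ _.
  have n0 : (0 <= n)%R by rewrite le_min w0 w0'.
  (* The difference is a completed square with factor min(w, w') / t. *)
  rewrite -subr_ge0.
  have -> : (t * (M * n * M) + t^-1 * (n * D ^+ 2) - 2 * (M * n) * D =
      t^-1 * n * (t * M - D) ^+ 2)%R by field; rewrite gt_eqF.
  by rewrite mulr_ge0 ?sqr_ge0// mulr_ge0.
have Q0 : (0 <= qW w * qW w')%R by rewrite mulr_ge0.
have := ler_wpM2l Q0 key; rewrite mulrDr => {}key.
apply: (le_trans _ (le_trans key _)); rewrite le_eqVlt; apply/orP; left; apply/eqP; ring.
Qed.

End noise_cauchy_schwarz.

(** * Cauchy-Schwarz inequality and spectral gap for bounded functions *)

Section bounded_inner.
Context d (T : measurableType d) (R : realType) (mu : probability T R).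
Implicit Types f g : T -> R.

Lemma inner_cauchy_schwarz f g : bounded_measurable f -> bounded_measurable g ->
  (inner mu f g ^+ 2 <= inner mu f f * inner mu g g)%R.
Proof.
move=> bf bg; apply: sqr_le_of_AMGM; try exact: inner_ge0.
move=> t t0.
have H (s : R) : (`|s| = 1 -> - (s * (2 * inner mu f g)) <=
    t * inner mu f f + t^-1 * inner mu g g)%R.
  move=> s1; have s2 : (s ^+ 2 = 1)%R by rewrite -[(s ^+ 2)%R]real_normK ?num_real// s1 expr1n.
  have := inner_ge0 mu (fun x => s * t * f x + g x)%R.
  have bs : bounded_measurable (fun x => s * t * f x + g x)%R.
    by apply: bounded_measurableD => //; exact: bounded_measurableZ.
  rewrite inner_linearl// !inner_linearr// (innerC mu g f).
  have -> : (s * t * (s * t * inner mu f f + inner mu f g) + (s * t * inner mu f g + inner mu g g)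
     = s ^+ 2 * t ^+ 2 * inner mu f f + t * (s * (2 * inner mu f g)) + inner mu g g)%R by ring.
  rewrite s2 mul1r => h.
  rewrite -(ler_pM2l t0) mulrDr !mulrA divff ?gt_eqF// mul1r; lra.
have h1 := H 1%R (normr1 _); have := H (-1)%R; rewrite normrN1 => /(_ erefl) h2.
by case: (ger0P (inner mu f g)) => _; lra.
Qed.

Lemma Lnorm2_sqr f : 'N[mu]_2%:E[EFin \o f] ^+ 2 = \int[mu]_x (f x * f x)%:E.
Proof.
have E : \int[mu]_x (`|(f x)%:E| `^ 2) = \int[mu]_x (f x * f x)%:E.
  apply: eq_integral => x _.
  by rewrite abse_EFin poweR_EFin powR_mulrn// real_normK ?num_real// expr2.
rewrite -E -powR_Lnorm//.
case: ('N[mu]_2%:E[EFin \o f]) (Lnorm_ge0 mu 2%:E (EFin \o f)) => //= [r r0|_].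
  by rewrite powR_mulrn// expr2 EFinM.
by rewrite pnatr_eq0/= mulyy.
Qed.

Lemma bounded_Lfun2 f : bounded_measurable f -> f \in Lfun mu 2%:E.
Proof.
move=> bf; apply/andP; split; rewrite inE/=; first exact: bf.1.
rewrite /finite_norm.
have : 'N[mu]_2%:E[EFin \o f] ^+ 2 < +oo.
  rewrite Lnorm2_sqr -EFin_bounded_Rintegral ?ltry//; exact: bounded_measurableM.
by case: ('N[mu]_2%:E[EFin \o f]) => [r _|//|//]; exact: ltry.
Qed.

Lemma bounded_centered_mean f : bounded_measurable f ->
  (\int[mu]_x centered mu f x = 0)%R.
Proof.
move=> bf; rewrite bounded_RintegralB//; last exact: bounded_measurable_cst.
by rewrite bounded_Rintegral_cst subrr.
Qed.

Lemma inner_centered f : bounded_measurable f ->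
  (inner mu (centered mu f) (centered mu f) =
   inner mu f f - (\int[mu]_x f x) ^+ 2)%R.
Proof.
move=> bf; set m := (\int[mu]_x f x)%R.
have b1 := bounded_measurable_cst T (1 : R).
have cE : centered mu f = (fun x => - m * cst 1 x + f x)%R.
  by apply/funext => x; rewrite /centered /= mulr1 addrC.
have bc : bounded_measurable (fun x => - m * cst 1 x + f x)%R.
  by apply: bounded_measurableD => //; exact: bounded_measurableZ.
rewrite cE inner_linearl// !inner_linearr// (innerC mu f (cst 1%R)).
have -> : inner mu (cst 1%R) f = m by apply: eq_Rintegral => x _; rewrite mul1r.
have -> : inner mu (cst 1%R) (cst 1%R) = 1%R.
  by rewrite /inner; under eq_Rintegral do rewrite mul1r; exact: bounded_Rintegral_cst.
by ring.
Qed.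

Variable Q : R.-pker T ~> T.
Hypothesis Qrev : reversible mu Q.
Local Notation D f := (inner mu f f - inner mu f (markov_op Q f))%R.

Lemma dirichlet_form_ge0 f : bounded_measurable f -> (0 <= D f)%R.
Proof.
move=> bf; rewrite -lee_fin -(dirichletE Qrev bf) mule_ge0 ?lee_fin ?invr_ge0//.
by apply: integral_ge0 => x _; apply: integral_ge0 => y _; rewrite lee_fin sqr_ge0.
Qed.

(** P fixes constants and is self-adjoint, so [b] drops out; used to normalise test functions for
    the gap. *)
Lemma dirichlet_form_affine (a b : R) f : bounded_measurable f ->
  D (fun x => a * f x + b)%R = (a ^+ 2 * D f)%R.
Proof.
move=> bf; have bb := bounded_measurable_cst T b.
have bPf := bounded_markov_op Q bf.
have E : markov_op Q (fun x => a * f x + b)%R = (fun x => a * markov_op Q f x + cst b x)%R.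
  by rewrite (markov_op_linear Q a bf bb) markov_op_cst.
have b1 : bounded_measurable (fun x => a * f x + cst b x)%R.
  by apply: bounded_measurableD => //; exact: bounded_measurableZ.
rewrite E -[(fun x => a * f x + b)%R]/(fun x => a * f x + cst b x)%R.
rewrite [inner mu _ (fun x => a * markov_op Q f x + _)%R]inner_linearr//.
rewrite !(inner_linearl mu a bf bb)// inner_linearr// inner_linearr//.
have -> : inner mu (cst b) (markov_op Q f) = inner mu (cst b) f.
  by rewrite markov_op_adjoint// markov_op_cst.
by ring.
Qed.

(** For [V > 0] the function (f - m) / sqrt V is admissible in the infimum; for [V = 0] the form is
    just nonnegative. A lower bound [e] instead of the gap itself also covers an infinite gap. *)
Lemma gap_le (e : R) f : e%:E <= right_spectral_gap mu Q -> bounded_measurable f ->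
  (e * inner mu (centered mu f) (centered mu f) <= D f)%R.
Proof.
move=> egap bf; have bc := bounded_centered mu bf.
set V := inner mu _ _; have V0 : (0 <= V)%R := inner_ge0 mu _.
have [V00|Vn0] := eqVneq V 0%R; first by rewrite V00 mulr0 dirichlet_form_ge0.
have Vgt0 : (0 < V)%R by rewrite lt_neqAle eq_sym Vn0.
pose a := (Num.sqrt V)^-1%R; have aV : (a ^+ 2 * V = 1)%R.
  by rewrite /a exprVn sqr_sqrtr// mulVf.
pose m := (\int[mu]_x f x)%R.
pose f' x := (a * f x + - (a * m))%R.
have f'E : f' = (fun x => a * centered mu f x)%R.
  by apply/funext => x; rewrite /f' /centered mulrBr.
have bf' : bounded_measurable f' by rewrite f'E; exact: bounded_measurableZ.
have : right_spectral_gap mu Q <= dirichlet mu Q f'.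
  apply: ereal_inf_lbound; exists f' => //; split.
  - exact: bounded_Lfun2.
  - rewrite -EFin_bounded_Rintegral// f'E bounded_RintegralZl//.
    by rewrite bounded_centered_mean// mulr0.
  - have N1 : 'N[mu]_2%:E[EFin \o f'] ^+ 2 = 1 ^+ 2.
      rewrite Lnorm2_sqr -EFin_bounded_Rintegral; last exact: bounded_measurableM.
      rewrite -/(inner mu f' f') f'E expe2 mule1.
      rewrite /inner; under eq_Rintegral do rewrite mulrACA.
      by rewrite bounded_RintegralZl ?aV//; exact: bounded_measurableM.
    move: (Lnorm_ge0 mu 2%:E (EFin \o f')) N1; move: ('N[mu]_2%:E[EFin \o f']) => N N0 N1.
    by apply/eqP; rewrite eq_le; apply/andP; split; apply: lee_sqrE => //; rewrite N1.
rewrite dirichletE// dirichlet_form_affine// => /(le_trans egap).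
rewrite lee_fin -(ler_pM2r Vgt0) => /le_trans; apply.
by rewrite mulrAC aV mul1r.
Qed.

End bounded_inner.

(** * Events of intermediate probability *)

Section nontrivial_event.
Local Open Scope ring_scope.
Context d (T : measurableType d) (R : realType) (mu : probability T R).

(* If [A] had measure [0] or [1] for every event [A], then
   [\P(c < c') = \int[mu]_x mu (c < c x)] would be [0] or [1] for two independent
   copies [c], [c'], whereas by symmetry it is [1/2]. *)
Lemma exists_nontrivial_event (c : T -> measurableTypeR R) : measurable_fun setT c ->
  (forall r : R, mu (c @^-1` [set r]) = 0%E) ->
  exists2 A, measurable A & (0 < mu A < 1)%E.
Proof.
move=> mc null; apply: contrapT => noA.
have mu01 A : measurable A -> mu A = 0%E \/ mu A = 1%E.
  move=> mA; have [->|A0] := eqVneq (mu A) 0%E; first by left.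
  have [->|A1] := eqVneq (mu A) 1%E; first by right.
  exfalso; apply: noA; exists A => //.
  by rewrite lt0e A0 measure_ge0/= lt_neqAle A1 probability_le1.
pose E := [set z : T * T | (c z.1 < c z.2 :> R)].
have mE : measurable E.
  have m1 : measurable_fun setT (fun z : T * T => c z.1 : R) by exact: measurableT_comp.
  have m2 : measurable_fun setT (fun z : T * T => c z.2 : R) by exact: measurableT_comp.
  by rewrite -[E]setTI; have /(_ measurableT [set true]) := measurable_fun_ltr m1 m2; apply.
pose B (z : T * T) : \bar R := (\1_E z)%:E.
have mB : measurable_fun setT B by exact/measurable_EFinP/measurable_indic.
have B0 z : (0 <= B z)%E by rewrite lee_fin.
pose phi x := (\int[mu]_y B (x, y))%E.
have mphi : measurable_fun setT phi.
  exact: (@measurable_fun_fubini_tonelli_F _ _ _ _ _ mu B mB B0).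
have mpsi : measurable_fun setT (fun x => \int[mu]_y B (y, x))%E.
  exact: (@measurable_fun_fubini_tonelli_G _ _ _ _ _ mu B mB B0).
have mB1 x : measurable_fun setT (fun y => B (x, y)).
  exact: (measurableT_comp mB (pair1_measurable x)).
have mB2 x : measurable_fun setT (fun y => B (y, x)).
  exact: (measurableT_comp mB (pair2_measurable x)).
(* For fixed [x] the two sections fill the complement of a level set of [c], which is null. *)
have phi1 x : (phi x + \int[mu]_y B (y, x) = 1)%E.
  have mcx : measurable (c @^-1` [set c x]).
    by rewrite -[X in measurable X]setTI; apply: mc => //; exact: measurable_set1.
  rewrite -ge0_integralD//.
  transitivity (\int[mu]_y (\1_(~` (c @^-1` [set c x])) y)%:E)%E.
    apply: eq_integral => y _; rewrite /B -EFinD; congr EFin.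
    have EE u v : ((u, v) \in E) = (c u < c v :> R) := asboolb _.
    have xy : (y \in c @^-1` [set c x]) = (c x == c y :> R).
      by apply/idP/eqP => [/set_mem//|xy]; exact/mem_set.
    rewrite !indicE in_setC xy !EE.
    by case: (ltgtP (c x : R) (c y)) => _; rewrite ?addr0 ?add0r.
  rewrite integral_indic//; last exact: measurableC.
  rewrite setIT; have := probability_setC mu mcx; rewrite null sube0; exact.
have I2 : (\int[mu]_x phi x + \int[mu]_x phi x = 1)%E.
  have {2}-> : (\int[mu]_x phi x = \int[mu]_x \int[mu]_y B (y, x))%E.
    exact: (@fubini_tonelli _ _ _ _ _ mu mu B mB B0).
  rewrite -ge0_integralD//.
  - under eq_integral do rewrite phi1.
    by rewrite integral_cst// mul1e; exact: probability_setT.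
  - by move=> x _; exact: integral_ge0.
  - by move=> x _; exact: integral_ge0.
have phi01 x : phi x = 0%E \/ phi x = 1%E.
  have mx : measurable (xsection E x) by exact: measurable_xsection.
  have -> : phi x = mu (xsection E x).
    rewrite -(setIT (xsection E x)) -integral_indic//.
    by apply: eq_integral => y _; rewrite /B !indicE mem_xsection.
  exact: mu01.
(* As [phi] only takes the values 0 and 1, its integral is the measure of [A], again 0 or 1; twice
   that cannot be 1. *)
pose A := phi @^-1` [set 1%E].
have mA : measurable A.
  by rewrite -[A]setTI; apply: mphi => //; exact: emeasurable_set1.
have phiA : (\int[mu]_x phi x = mu A)%E.
  rewrite -(setIT A) -integral_indic//; apply: eq_integral => x _.
  rewrite indicE; have [xA|xA] := boolP (x \in A).
    by have /set_mem := xA.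
  by have [->//|p1] := phi01 x; move/negP : xA; case; exact/mem_set.
move: I2; rewrite phiA; have [->|->] := mu01 A mA.
  by rewrite adde0 => /eqP; rewrite eq_sym onee_eq0.
by rewrite -EFinD => h; have : (1 + 1 = 1 :> R)%R by [apply: EFin_inj]; lra.
Qed.

End nontrivial_event.

(** At [a = 0] both sides vanish, so the convention for division by zero does no harm to the
    flows. *)
Lemma mulr_min1_div (R : realFieldType) (a b : R) : (0 <= a)%R -> (0 <= b)%R ->
  (a * Num.min 1 (b / a) = Num.min a b)%R.
Proof.
move=> a0 b0; have [->|an0] := eqVneq a 0%R; first by rewrite mul0r min_l.
by rewrite minr_pMr// mulr1 mulrCA divff// mulr1.
Qed.

(** * The pseudo-marginal kernel *)

Section pseudo_marginal_comparison.
Context (R : realType) (d : nat).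
Local Notation RR := (measurableTypeR R).
Local Notation TT := (d.-tuple RR).
Local Notation lebd := (lebesgue_tuple R d).
Local Notation leb := (@lebesgue_measure R).
Variables (X : set TT) (mX : measurable X).
Variables (pi : density lebd X) (q : proposal lebd X).
Variables (W : set RR) (mW : measurable W) (W0 : forall w : R, W w -> (0 <= w)%R).
Variable qw : density leb W.
Hypothesis qw_mean : \int[leb]_(w in W) (w * qw w)%:E = 1.

Local Notation mh := (mh_target mX pi).
Local Notation mhQ := (mh_kernel mX pi q).
Local Notation pm := (pm_target mX pi mW W0 qw_mean).
Local Notation pmQ := (pm_kernel mX pi q mW W0 qw).
Local Notation nu := (nu_prob mW W0 qw_mean).

Definition mh_flow : TT * TT -> R := flow_density pi q (mh_ratio pi q).

Definition pm_flow : (TT * RR) * (TT * RR) -> R :=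
  flow_density (pm_target_density mX pi mW W0 qw_mean) (pm_proposal mX q mW qw)
    (pm_ratio pi q).

Lemma mh_flowE x y : mh_flow (x, y) =
  (if (x \in X) && (y \in X) then Num.min (pi x * q x y) (pi y * q y x) else 0)%R.
Proof.
rewrite /mh_flow /flow_density /restricted_density /move_density /= !patchE in_setX/=.
case: ifPn => xX /=; last by rewrite mul0r.
case: ifPn => yX /=; last by rewrite mulr0.
move/set_mem in xX; move/set_mem in yX.
have a0 : (0 <= pi x * q x y)%R by rewrite mulr_ge0 ?density_ge0 ?proposal_ge0.
have b0 : (0 <= pi y * q y x)%R by rewrite mulr_ge0 ?density_ge0 ?proposal_ge0.
by rewrite -(mulr_min1_div a0 b0) /mh_ratio mulrCA mulrC.
Qed.

(** The target contributes [w * qw w] and the proposal [qw v]: the factor [qw w * qw v] stays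
    outside, while [w] and [v] join the two arguments of the minimum. *)
Lemma pm_flowE x w y v : pm_flow ((x, w), (y, v)) =
  (if [&& x \in X, w \in W, y \in X & v \in W] then
     qw w * qw v * Num.min (pi x * q x y * w) (pi y * q y x * v) else 0)%R.
Proof.
rewrite /pm_flow /flow_density /restricted_density /move_density /= !patchE !in_setX/=.
case: (boolP (x \in X)) => xX; last by rewrite /= mul0r.
case: (boolP (w \in W)) => wW; last by rewrite /= mul0r.
case: (boolP (y \in X)) => yX; last by rewrite /= mulr0.
case: (boolP (v \in W)) => vW; last by rewrite /= mulr0.
rewrite /=.
move/set_mem in xX; move/set_mem in yX; move/set_mem in wW; move/set_mem in vW.
have a0 : (0 <= pi x * q x y * w)%R by rewrite !mulr_ge0 ?density_ge0 ?proposal_ge0// W0.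
have b0 : (0 <= pi y * q y x * v)%R by rewrite !mulr_ge0 ?density_ge0 ?proposal_ge0// W0.
rewrite -(mulr_min1_div a0 b0) /pm_ratio /mh_ratio/= /Defs.nu.
have -> : (pi y * q y x / (pi x * q x y) * (v / w) =
  pi y * q y x * v / (pi x * q x y * w))%R by rewrite mulrACA -invfM.
by ring.
Qed.

Lemma mh_reversible : reversible mh mhQ.
Proof.
apply: metropolis_reversible => x y; rewrite -/(mh_flow (x, y)) -/(mh_flow (y, x)).
by rewrite !mh_flowE andbC minC.
Qed.

Lemma pm_reversible : reversible pm pmQ.
Proof.
apply: metropolis_reversible => -[x w] [y v].
rewrite -/(pm_flow ((x, w), (y, v))) -/(pm_flow ((y, v), (x, w))).
rewrite !pm_flowE minC [(qw w * _)%R]mulrC.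
by case: (x \in X); case: (y \in X); case: (w \in W); case: (v \in W).
Qed.

(** For nonnegative numbers, min(a w, b v) >= min(a, b) min(w, v). *)
Lemma mh_flow_min_weight_le x w y v :
  (mh_flow (x, y) * min_weight qw (w, v) <= pm_flow ((x, w), (y, v)))%R.
Proof.
rewrite mh_flowE pm_flowE /min_weight /restricted_density/= !patchE.
case: (boolP (x \in X)) => xX; last by rewrite mul0r.
case: (boolP (y \in X)) => yX; last by rewrite mul0r andbF.
case: (boolP (w \in W)) => wW; last by rewrite /= !mul0r mulr0.
case: (boolP (v \in W)) => vW; last by rewrite /= mulr0 mul0r mulr0.
rewrite /=.
move/set_mem in xX; move/set_mem in yX; move/set_mem in wW; move/set_mem in vW.
have a0 : (0 <= pi x * q x y)%R by rewrite mulr_ge0 ?density_ge0 ?proposal_ge0.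
have b0 : (0 <= pi y * q y x)%R by rewrite mulr_ge0 ?density_ge0 ?proposal_ge0.
have w0 := W0 wW; have v0 := W0 vW.
rewrite mulrCA; apply: ler_wpM2l; first by rewrite mulr_ge0 ?density_ge0.
have ma : (0 <= Num.min (pi x * q x y) (pi y * q y x))%R by rewrite le_min a0 b0.
have mw : (0 <= Num.min (w : R) (v : R))%R by rewrite le_min w0 v0.
rewrite le_min; apply/andP; split; apply: ler_pM => //; by rewrite ge_min lexx ?orbT.
Qed.

(** The conditional mean given theta: under the target, theta and w are independent with laws [mh]
    and [nu]. *)
Definition noise_mean (g : TT * RR -> R) (x : TT) : R := (\int[nu]_w g (x, w))%R.

Lemma ge0_integral_pm_target (F : TT * RR -> \bar R) : measurable_fun setT F ->
  (forall z, 0 <= F z) ->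
  \int[pm]_z F z = \int[mh]_x \int[nu]_w F (x, w).
Proof.
move=> mF F0.
have mF1 x : measurable_fun setT (fun w => F (x, w)).
  exact: (measurableT_comp mF (pair1_measurable x)).
rewrite ge0_integral_density_prob//.
pose piX := restricted_density pi.
pose nuW := restricted_density (nu_density W0 qw_mean).
have mpi : measurable_fun setT piX by exact: measurable_restricted_density.
have mnu : measurable_fun setT nuW by exact: measurable_restricted_density.
have pi0 x : (0 <= piX x)%R by exact: restricted_density_ge0.
have nu0 w : (0 <= nuW w)%R by exact: restricted_density_ge0.
transitivity (\int[sigma_finite_prod lebd leb]_z ((piX z.1 * nuW z.2)%:E * F z)).
  apply: eq_integral => z _; congr (_%:E * _).
  rewrite /piX /nuW /restricted_density !patchE in_setX.
  by case: (z.1 \in X); case: (z.2 \in W) => //=; rewrite ?mul0r ?mulr0.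
rewrite integral_sigma_finite_prod; last 2 first.
- apply: emeasurable_funM => //; apply/measurable_EFinP.
  by apply: measurable_funM; exact: measurableT_comp.
- by move=> z; rewrite mule_ge0// lee_fin mulr_ge0.
rewrite ge0_integral_density_prob; last 2 first.
- exact: (@measurable_fun_fubini_tonelli_F _ _ _ _ _ nu F mF F0).
- by move=> x; exact: integral_ge0.
apply: eq_integral => x _; rewrite ge0_integral_density_prob// -ge0_integralZl//.
- by apply: eq_integral => w _; rewrite /= EFinM muleA.
- by apply: emeasurable_funM => //; exact/measurable_EFinP.
- by move=> w _; rewrite mule_ge0 ?lee_fin.
- by rewrite lee_fin.
Qed.

Lemma bounded_noise_mean g : bounded_measurable g -> bounded_measurable (noise_mean g).
Proof.
move=> [mg [M gM]].
have bg1 x : bounded_measurable (fun w => g (x, w)).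
  split; last by exists M => w; exact: gM.
  exact: (measurableT_comp mg (pair1_measurable x)).
split; last by exists M => x; apply: norm_bounded_Rintegral => // w; exact: gM.
have -> : noise_mean g = fun x => (fine (\int[nu]_w (g (x, w) + M)%:E) - M)%R.
  apply/funext => x; apply/eqP; rewrite -subr_eq opprK.
  rewrite -[X in (_ + X)%R](bounded_Rintegral_cst nu).
  by rewrite -bounded_RintegralD//; exact: bounded_measurable_cst.
apply: measurable_funB => //; apply: measurableT_comp; first exact: fine_measurable.
apply: (@measurable_fun_fubini_tonelli_F _ _ _ _ _ nu (fun z => (g z + M)%:E)).
  by apply/measurable_EFinP; exact: measurable_funD.
by move=> z; rewrite lee_fin -lerBlDr sub0r; have := gM z; rewrite ler_norml => /andP[].
Qed.

Lemma bounded_Rintegral_pm_target g : bounded_measurable g ->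
  (\int[pm]_z g z = \int[mh]_x noise_mean g x)%R.
Proof.
move=> bg; have [mg [M gM]] := bg.
have bM d' (T' : measurableType d') := bounded_measurable_cst T' M.
have bg1 x : bounded_measurable (fun w => g (x, w)).
  split; last by exists M => w; exact: gM.
  exact: (measurableT_comp mg (pair1_measurable x)).
have bgM : bounded_measurable (fun z => g z + M)%R by exact: bounded_measurableD.
(* Adding the bound [M] makes the integrand nonnegative, so that Tonelli applies; [M] then
   cancels. *)
have H : (\int[pm]_z (g z + M) = \int[mh]_x (noise_mean g x + M))%R.
  apply: EFin_inj; rewrite !EFin_bounded_Rintegral//; last first.
    by apply: bounded_measurableD => //; exact: bounded_noise_mean.
  rewrite ge0_integral_pm_target; last 2 first.
  - by apply/measurable_EFinP; exact: bgM.1.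
  - by move=> z; rewrite lee_fin -lerBlDr sub0r; have := gM z; rewrite ler_norml => /andP[].
  apply: eq_integral => x _.
  rewrite -[X in (_ + X)%:E](bounded_Rintegral_cst nu M) -bounded_RintegralD// EFin_bounded_Rintegral//.
  exact: bounded_measurableD.
move: H; rewrite bounded_RintegralD// bounded_RintegralD ?bounded_Rintegral_cst//.
  by move/addIr.
exact: bounded_noise_mean.
Qed.

Lemma noise_mean_fst (f : TT -> R) : noise_mean (f \o fst) = f.
Proof. by apply/funext => x; exact: (bounded_Rintegral_cst nu (f x)). Qed.

Lemma inner_pm_fst (c : TT -> R) g : bounded_measurable c -> bounded_measurable g ->
  inner pm (c \o fst) g = inner mh c (noise_mean g).
Proof.
move=> bc bg; rewrite /inner bounded_Rintegral_pm_target; last first.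
  by apply: bounded_measurableM => //; exact: bounded_measurable_comp.
apply: eq_Rintegral => x _; rewrite /noise_mean/= bounded_RintegralZl//.
case: bg => mg [M gM]; split; last by exists M => w; exact: gM.
exact: (measurableT_comp mg (pair1_measurable x)).
Qed.

Lemma centered_pm_fst (f : TT -> R) : bounded_measurable f ->
  centered pm (f \o fst) = centered mh f \o fst.
Proof.
move=> bf; apply/funext => z; rewrite /centered/=; congr (_ - _)%R.
rewrite (bounded_Rintegral_pm_target (g := f \o fst)) ?noise_mean_fst//.
exact: bounded_measurable_comp.
Qed.

Lemma mh_flow_ge0 z : (0 <= mh_flow z)%R.
Proof. by apply: flow_density_ge0; exact: mh_ratio_ge0. Qed.

Lemma measurable_mh_flow : measurable_fun setT mh_flow.
Proof. by apply: measurable_flow_density => //; exact: measurable_mh_ratio. Qed.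

Lemma pm_flow_ge0 z : (0 <= pm_flow z)%R.
Proof. by apply: flow_density_ge0; exact: pm_ratio_ge0. Qed.

Lemma measurable_pm_flow : measurable_fun setT pm_flow.
Proof.
apply: measurable_flow_density; [exact: measurable_XW|exact: measurable_pm_ratio].
Qed.

Lemma dirichlet_noise_mean_le (r : R) g : R_S qw = r%:E -> bounded_measurable g ->
  dirichlet mh mhQ (noise_mean g) <= r%:E * dirichlet pm pmQ g.
Proof.
move=> Rr bg; have [mg _] := bg; have bng := bounded_noise_mean bg.
have r0 : (0 <= r)%R by rewrite -lee_fin -Rr R_S_ge0.
rewrite dirichlet_metropolis; last exact: bng.1.
rewrite dirichlet_metropolis// muleCA; apply: lee_wpmul2l; first by rewrite lee_fin invr_ge0.
pose s z : R := mh_flow z; pose k := min_weight qw.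
pose K z z' : \bar R := (s (z.1, z'.1) * k (z.2, z'.2) * (g z' - g z) ^+ 2)%:E.
have k0 z : (0 <= k z)%R by exact: min_weight_ge0.
have mk : measurable_fun setT k by exact: measurable_min_weight.
have s0 z : (0 <= s z)%R by exact: mh_flow_ge0.
have ms : measurable_fun setT s by exact: measurable_mh_flow.
pose J x y : \bar R := \int[leb]_w \int[leb]_v (k (w, v) * (g (y, v) - g (x, w)) ^+ 2)%:E.
have J0 x y : 0 <= J x y.
  apply: integral_ge0 => w _; apply: integral_ge0 => v _.
  by rewrite lee_fin mulr_ge0 ?sqr_ge0.
have mJ : measurable_fun setT (fun z : TT * TT => J z.1 z.2).
  apply: (@measurable_fun_fubini_tonelli_F _ _ _ _ _ leb (fun u : (TT * TT) * RR =>
    \int[leb]_v (k (u.2, v) * (g (u.1.2, v) - g (u.1.1, u.2)) ^+ 2)%:E)); last first.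
    by move=> u; apply: integral_ge0 => v _; rewrite lee_fin mulr_ge0 ?sqr_ge0.
  apply: (@measurable_fun_fubini_tonelli_F _ _ _ _ _ leb (fun u : ((TT * TT) * RR) * RR =>
    (k (u.1.2, u.2) * (g (u.1.1.2, u.2) - g (u.1.1.1, u.1.2)) ^+ 2)%:E)); last first.
    by move=> u; rewrite lee_fin mulr_ge0 ?sqr_ge0.
  apply/measurable_EFinP; apply: measurable_funM.
    by apply: (measurableT_comp mk); apply: measurable_fun_pair => //; exact: measurableT_comp.
  have m3 : measurable_fun setT (fun u : ((TT * TT) * RR) * RR => u.1.1).
    by apply: measurableT_comp.
  apply: measurable_funX; apply: measurable_funB.
    by apply: (measurableT_comp mg); apply: measurable_fun_pair => //; exact: measurableT_comp m3.
  apply: (measurableT_comp mg); apply: measurable_fun_pair => //; exact: measurableT_comp.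
pose F (z : TT * TT) : \bar R := (s z)%:E * J z.1 z.2.
have mF : measurable_fun setT F.
  by apply: emeasurable_funM => //; exact/measurable_EFinP.
have F0 z : 0 <= F z by rewrite mule_ge0 ?lee_fin.
(* For fixed [(x, y)], [noise_cauchy_schwarz] with [u = g (x, _)] and [v = g (y, _)] bounds the
   squared difference of the noise means by [r * J x y]. *)
apply: (@le_trans _ _ (r%:E * \int[lebd]_x \int[lebd]_y ((s (x, y))%:E * J x y))).
  rewrite -ge0_integralZl//; try by
    [exact: (@measurable_fun_fubini_tonelli_F _ _ _ _ _ lebd F mF F0)
    |move=> x _; apply: integral_ge0 => y _; exact: (F0 (x, y))].
  pose L (z : TT * TT) : \bar R := (flow_density pi q (mh_ratio pi q) z *
    (noise_mean g z.2 - noise_mean g z.1) ^+ 2)%:E.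
  have mL : measurable_fun setT L.
    apply/measurable_EFinP/measurable_funM; first exact: measurable_mh_flow.
    by apply: measurable_funX; apply: measurable_funB; apply: measurableT_comp => //; exact: bng.1.
  have L0 z : 0 <= L z.
    by rewrite lee_fin mulr_ge0 ?sqr_ge0//; exact: mh_flow_ge0.
  have mFx x : measurable_fun setT (fun y => (s (x, y))%:E * J x y).
    exact: (measurableT_comp mF (pair1_measurable x)).
  apply: ge0_le_integral => //.
  - by move=> x _; apply: integral_ge0 => y _; exact: (L0 (x, y)).
  - exact: (@measurable_fun_fubini_tonelli_F _ _ _ _ _ lebd L mL L0).
  - apply: measurable_funeM.
    exact: (@measurable_fun_fubini_tonelli_F _ _ _ _ _ lebd F mF F0).
  move=> x _; rewrite -ge0_integralZl//; try by move=> y _; exact: (F0 (x, y)).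
  apply: ge0_le_integral => //.
  - by move=> y _; exact: (L0 (x, y)).
  - exact: (measurableT_comp mL (pair1_measurable x)).
  - exact: measurable_funeM.
  move=> y _; rewrite EFinM muleCA; apply: lee_wpmul2l; first by rewrite lee_fin; exact: s0.
  have bgx x' : bounded_measurable (fun w => g (x', w)).
    case: bg => _ [M gM]; split; last by exists M => w; exact: gM.
    exact: (measurableT_comp mg (pair1_measurable x')).
  exact: (noise_cauchy_schwarz mW W0 qw_mean (bgx x) (bgx y) Rr).
apply: lee_wpmul2l; first by rewrite lee_fin.
(* Over pairs [((x, w), (y, v))] the weight is [mh_flow] times [min_weight], which the
   pseudo-marginal flow dominates pointwise. *)
rewrite -(double_integral_sigma_finite_prod lebd leb ms s0 mk k0 mg).
have mK : measurable_fun setT (fun z : (TT * RR) * (TT * RR) => K z.1 z.2).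
  apply/measurable_EFinP; apply: measurable_funM.
    apply: measurable_funM.
      by apply: (measurableT_comp ms); apply: measurable_fun_pair; exact: measurableT_comp.
    by apply: (measurableT_comp mk); apply: measurable_fun_pair; exact: measurableT_comp.
  by apply: measurable_funX; apply: measurable_funB; exact: measurableT_comp.
have K0 z : 0 <= K z.1 z.2 by rewrite /K lee_fin mulr_ge0 ?sqr_ge0// mulr_ge0.
pose L z : \bar R := (pm_flow z * (g z.2 - g z.1) ^+ 2)%:E.
have mL : measurable_fun setT L.
  apply/measurable_EFinP; apply: measurable_funM; first exact: measurable_pm_flow.
  by apply: measurable_funX; apply: measurable_funB; exact: measurableT_comp.
have L0 z : 0 <= L z by rewrite /L lee_fin mulr_ge0 ?sqr_ge0//; exact: pm_flow_ge0.
apply: ge0_le_integral => //.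
- by move=> z _; apply: integral_ge0 => z' _; exact: (K0 (z, z')).
- exact: (@measurable_fun_fubini_tonelli_F _ _ _ _ _ (sigma_finite_prod lebd leb) (fun z => K z.1 z.2) mK K0).
- exact: (@measurable_fun_fubini_tonelli_F _ _ _ _ _ (sigma_finite_prod lebd leb) L mL L0).
move=> [x w] _; apply: ge0_le_integral => //.
- by move=> z' _; exact: (K0 ((x, w), z')).
- exact: (measurableT_comp mK (pair1_measurable (x, w))).
- exact: (measurableT_comp mL (pair1_measurable (x, w))).
move=> [y v] _; rewrite /K /L lee_fin/=; apply: ler_wpM2r; first exact: sqr_ge0.
exact: mh_flow_min_weight_le.
Qed.

End pseudo_marginal_comparison.

(** * Nondegeneracy of the target and the variance bound *)

Section coordinate_null.
Context (R : realType).
Local Notation RR := (measurableTypeR R).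

Lemma lebesgue_tuple_hyperplane n (r : R) :
  lebesgue_tuple R n.+1 ((fun x : n.+1.-tuple RR => thead x) @^-1` [set r]) = 0.
Proof.
rewrite /= /lebesgue_cons.
have -> : @cons_pair R n @^-1` ((fun x : n.+1.-tuple RR => thead x) @^-1` [set r]) =
    [set (r : RR)] `*` [set: n.-tuple RR].
  apply/seteqP; split => -[a t] /=; rewrite /cons_pair theadE; first by [].
  by case.
rewrite /sigma_finite_prod product_measure1E//.
by rewrite [X in X * _]lebesgue_measure_set1 mul0e.
Qed.

End coordinate_null.

Section pseudo_marginal_variance.
Context (R : realType) (d : nat) (d_gt0 : (0 < d)%N).
Local Notation RR := (measurableTypeR R).
Local Notation TT := (d.-tuple RR).
Local Notation lebd := (lebesgue_tuple R d).
Local Notation leb := (@lebesgue_measure R).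
Variables (X : set TT) (mX : measurable X).
Variables (pi : density lebd X) (q : proposal lebd X).
Local Notation mh := (mh_target mX pi).
Local Notation mhQ := (mh_kernel mX pi q).

(** For [d > 0] the first coordinate has no atoms under a density, hence some event has probability
    a strictly between 0 and 1; its indicator has variance a - a^2. *)
Lemma exists_nonconstant : exists2 f : TT -> R, bounded_measurable f &
  (0 < inner mh (centered mh f) (centered mh f))%R.
Proof.
have [A mA /andP[A0 A1]] : exists2 A, measurable A & 0 < mh A < 1.
  case: (d) d_gt0 X mX pi => // n _ Y mY p.
  apply: (exists_nontrivial_event (c := fun x : n.+1.-tuple RR => thead x)).
    exact: measurable_tnth.
  move=> r; rewrite /mh_target/= /density_prob.
  have mH : measurable ((fun x : n.+1.-tuple RR => thead x) @^-1` [set r]).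
    rewrite -[X in measurable X]setTI.
    have mc : measurable_fun setT (fun x : n.+1.-tuple RR => thead x) by exact: measurable_tnth.
    by apply: mc => //; exact: measurable_set1.
  have H0 : lebesgue_tuple R n.+1
      (((fun x : n.+1.-tuple RR => thead x) @^-1` [set r]) `&` Y) = 0.
    apply: (@subset_measure0 _ _ _ _ _ ((fun x : n.+1.-tuple RR => thead x) @^-1` [set r])) => //.
    - exact: measurableI.
    - exact: lebesgue_tuple_hyperplane.
  rewrite null_set_integral//.
  - exact: measurableI.
  - apply/measurable_EFinP; apply: measurable_funS (density_measurable p) => //.
have bA := bounded_measurable_indic R mA.
exists \1_A => //.
pose a := fine (mh A).
have afin : mh A \is a fin_num by exact: fin_num_measure.
have aE : (\int[mh]_x \1_A x = a)%R.
  by rewrite /Rintegral integral_indic// setIT.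
have a0 : (0 < a)%R by rewrite fine_gt0// A0/= ltey_eq afin.
have a1 : (a < 1)%R by rewrite -lte_fin fineK.
have -> : inner mh (centered mh \1_A) (centered mh \1_A) = (a - a ^+ 2)%R.
  rewrite inner_centered// aE; congr (_ - _)%R; rewrite -aE.
  by apply: eq_Rintegral => x _; rewrite indicE; case: (_ \in _); rewrite ?mulr1 ?mulr0.
by rewrite subr_gt0 expr2 gtr_pMr.
Qed.

Hypothesis gap_gt0 : 0 < right_spectral_gap mh mhQ.

Lemma gap_fin : exists2 e : R, (0 < e)%R & right_spectral_gap mh mhQ = e%:E.
Proof.
case: (right_spectral_gap mh mhQ) gap_gt0 (@gap_le _ _ _ mh mhQ (mh_reversible mX pi q)) => //.
  by move=> e e0 _; exists e.
move=> _ gle; exfalso.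
have [f bf V0] := exists_nonconstant.
have := inner_markov_op_geN (mh_reversible mX pi q) (bounded_centered mh bf).
set V := inner _ _ _ in V0 *.
set D := (inner mh f f - inner mh f (markov_op mhQ f))%R.
(* An infinite gap would allow e = (D + 1) / V, that is D + 1 <= D. *)
have := gle (V^-1 * (D + 1))%R f (leey _) bf.
by rewrite -/V -/D mulrAC mulVf ?gt_eqF// mul1r; lra.
Qed.

Variables (W : set RR) (mW : measurable W) (W0 : forall w : R, W w -> (0 <= w)%R).
Variable qw : density leb W.
Hypothesis qw_mean : \int[leb]_(w in W) (w * qw w)%:E = 1.
Local Notation pm := (pm_target mX pi mW W0 qw_mean).
Local Notation pmQ := (pm_kernel mX pi q mW W0 qw).
Local Notation pm_rev := (pm_reversible mX pi q mW W0 qw_mean).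
Local Notation mh_rev := (mh_reversible mX pi q).

(** The pairing with [g] only sees its centred noise mean; Cauchy-Schwarz, the gap of [mhQ] (factor
    1 / e) and the comparison of Dirichlet forms (factor r) follow in turn. *)
Lemma pm_inner_le (e r : R) f g : (0 < e)%R -> right_spectral_gap mh mhQ = e%:E ->
  R_S qw = r%:E -> bounded_measurable f -> bounded_measurable g ->
  (inner pm (centered pm (f \o fst)) g ^+ 2 <=
   r / e * inner pm (centered pm (f \o fst)) (centered pm (f \o fst)) *
   (inner pm g g - inner pm g (markov_op pmQ g)))%R.
Proof.
move=> e0 gape Rr bf bg; have bc := bounded_centered mh bf.
have bng := bounded_noise_mean mW W0 qw_mean bg.
rewrite centered_pm_fst// !inner_pm_fst ?noise_mean_fst//; last first.
  exact: bounded_measurable_comp.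
set h := noise_mean _ _ _ _ in bng *.
have hc : inner mh (centered mh f) h = inner mh (centered mh f) (centered mh h).
  have -> : centered mh h = (fun x => - (\int[mh]_y h y) * 1 + h x)%R.
    by apply/funext => x; rewrite /centered mulr1 addrC.
  rewrite (inner_linearr mh _ (bounded_measurable_cst _ 1%R))//.
  rewrite [inner mh _ (fun=> 1%R)](_ : _ = 0%R) ?mulr0 ?add0r//.
  rewrite /inner; under eq_Rintegral do rewrite mulr1.
  exact: bounded_centered_mean.
rewrite hc; have bch := bounded_centered mh bng.
apply: (le_trans (inner_cauchy_schwarz mh bc bch)).
rewrite [(r / e * _)%R]mulrC -mulrA; apply: ler_wpM2l; first exact: inner_ge0.
have H1 := gap_le mh_rev (eq_ind_r (fun z => e%:E <= z) (lexx _) gape) bng.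
have H2 := dirichlet_noise_mean_le mX pi q mW W0 qw_mean Rr bg.
rewrite (dirichletE mh_rev bng) (dirichletE pm_rev bg) -EFinM lee_fin in H2.
rewrite mulrAC ler_pdivlMr// mulrC.
exact: le_trans H1 H2.
Qed.

(** At [m = 0] the bound on paired sums reads V / 2 <= (r / e) V with V > 0. It makes the
    coefficient 2 r / e - 1 nonnegative. *)
Lemma R_S_gap_ge (e r : R) : (0 < e)%R -> right_spectral_gap mh mhQ = e%:E ->
  R_S qw = r%:E -> (1 <= 2 * (r / e))%R.
Proof.
move=> e0 gape Rr; have [f bf V0] := exists_nonconstant.
have r0 : (0 <= r)%R by rewrite -lee_fin -Rr (R_S_ge0 mW W0).
have bF := bounded_measurable_comp (measurable_fst : measurable_fun setT (@fst TT RR)) bf.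
have bC := bounded_centered pm bF.
have VE : inner pm (centered pm (f \o fst)) (centered pm (f \o fst)) =
    inner mh (centered mh f) (centered mh f).
  have bc := bounded_centered mh bf.
  rewrite centered_pm_fst// inner_pm_fst ?noise_mean_fst//.
  exact: bounded_measurable_comp.
have C0 : (0 <= r / e * inner pm (centered pm (f \o fst)) (centered pm (f \o fst)))%R.
  by rewrite mulr_ge0 ?inner_ge0// divr_ge0// ltW.
have := paired_sum_le pm_rev bC 0 C0 (fun g bg => pm_inner_le e0 gape Rr bf bg).
rewrite /paired_sum big_ord0 add0r -[autocov _ _ _ _]/(inner pm _ _) VE.
rewrite ler_pM2r// => h; lra.
Qed.

End pseudo_marginal_variance.

Theorem theorem1 (R : realType) (d : nat) (d_gt0 : (0 < d)%N)
  (X : set (d.-tuple (measurableTypeR R))) (mX : measurable X)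
  (pi : density (lebesgue_tuple R d) X) (q : proposal (lebesgue_tuple R d) X)
  (W : set (measurableTypeR R)) (mW : measurable W)
  (W_ge0 : forall w : R, W w -> (0 <= w)%R)
  (qw : density (@lebesgue_measure R) W)
  (qw_mean : \int[@lebesgue_measure R]_(w in W) (w * qw w)%:E = 1)
  (gap_gt0 : 0 < right_spectral_gap (mh_target mX pi) (mh_kernel mX pi q))
  (h : d.-tuple (measurableTypeR R) -> R)
  (hL2 : h \in Lfun (mh_target mX pi) 2%:E)
  (d' : measure_display) (Omega : measurableType d') (P : probability Omega R)
  (Z : nat -> {RV P >-> (d.-tuple (measurableTypeR R) * measurableTypeR R)%type})
  (Z_chain : markov_chain Z (pm_target mX pi mW W_ge0 qw_mean)
                            (pm_kernel mX pi q mW W_ge0 qw)) :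
  cvgn (scaled_variance Z (h \o fst)) /\
  asymptotic_variance Z (h \o fst) <=
    (2%:E * R_S qw / right_spectral_gap (mh_target mX pi) (mh_kernel mX pi q) - 1)
    * 'N[mh_target mX pi]_2%:E [EFin \o h] ^+ 2.
Proof.
set mh := mh_target mX pi in hL2 *.
pose pm := pm_target mX pi mW W_ge0 qw_mean.
have mh' : measurable_fun setT h by have /andP[/[!inE]] := hL2.
have mhf : measurable_fun setT (h \o fst : d.-tuple (measurableTypeR R) * measurableTypeR R -> R).
  exact: measurableT_comp.
(* The theta-marginal of the pseudo-marginal target is [mh], so both second moments agree. *)
have normE : \int[pm]_z (h z.1 * h z.1)%:E = \int[mh]_x (h x * h x)%:E.
  rewrite ge0_integral_pm_target.
  - apply: eq_integral => x _ /=; rewrite integral_cst//.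
    by rewrite [X in _ * X]probability_setT mule1.
  - by apply/measurable_EFinP; exact: measurable_funM.
  - by move=> z; rewrite lee_fin -expr2 sqr_ge0.
have hfL2 : (h \o fst) \in Lfun pm 2%:E.
  apply/andP; split; rewrite inE//=.
  have : 'N[mh]_2%:E[EFin \o h] < +oo by have /andP[_ /[!inE]] := hL2.
  have E : 'N[pm]_2%:E[EFin \o (h \o fst)] ^+ 2 = 'N[mh]_2%:E[EFin \o h] ^+ 2.
    by rewrite !Lnorm2_sqr.
  rewrite /finite_norm; move: E.
  case: ('N[mh]_2%:E[EFin \o h]) (Lnorm_ge0 mh 2%:E (EFin \o h)) => // s _.
  by case: ('N[pm]_2%:E[EFin \o (h \o fst)]) => [s'|//|//] _ _; rewrite ltry.
have [cv bound] := asymptotic_variance_le (pm_reversible mX pi q mW W_ge0 qw_mean) Z_chain hfL2.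
split=> //.
have [e e0 gape] := gap_fin d_gt0 gap_gt0.
have ihh : mh.-integrable setT (EFin \o (fun x => h x * h x)%R).
  exact/Lfun1_integrable/Lfun2_mul_Lfun1.
have ipm : pm.-integrable setT (EFin \o (fun z => (h \o fst) z * (h \o fst) z)%R).
  exact/Lfun1_integrable/Lfun2_mul_Lfun1.
pose S2 := (\int[mh]_x (h x * h x))%R.
have S2E : \int[mh]_x (h x * h x)%:E = S2%:E.
  by rewrite /S2 /Rintegral fineK//; exact: integrable_fin_num ihh.
have pmS2 : (\int[pm]_z ((h \o fst) z * (h \o fst) z) = S2)%R.
  by rewrite /S2 /Rintegral -normE.
have S20 : (0 <= S2)%R by apply: Rintegral_ge0 => x _; rewrite -expr2 sqr_ge0.
rewrite Lnorm2_sqr S2E gape.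
set m := (\int[pm]_z (h \o fst) z)%R in bound; rewrite pmS2 in bound.
have einvE : (e%:E)^-1 = (e^-1)%:E by rewrite inver gt_eqF.
have trE n : trunc n (h \o fst) = trunc n h \o fst :> (d.-tuple (measurableTypeR R) * measurableTypeR R -> R).
  by [].
case RSE : (R_S qw) => [r| |].
- have r0 : (0 <= r)%R by rewrite -lee_fin -RSE (R_S_ge0 mW W_ge0).
  have K0 : (0 <= r / e)%R by rewrite divr_ge0// ltW.
  have K1 := R_S_gap_ge d_gt0 mW W_ge0 qw_mean e0 gape RSE.
  apply: (le_trans (bound (r / e)%R K0 _)).
    move=> f g bf bg [n fE]; rewrite fE trE.
    exact: (pm_inner_le mW W_ge0 qw_mean e0 gape RSE (bounded_trunc n mh') bg).
  have -> : 2%:E * r%:E / e%:E - 1 = (2 * (r / e) - 1)%:E.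
    by rewrite einvE -!EFinM -mulrA EFinB.
  rewrite -EFinM lee_fin.
  (* [K1] allows replacing the variance [S2 - m ^+ 2] by [S2]. *)
  apply: ler_wpM2l; first by lra.
  by rewrite gerBl sqr_ge0.
(* For infinite [R_S] the right side is +oo unless [S2 = 0], when it is 0 by convention; then all
   truncations vanish in L2 and [K = 0] is admissible. *)
- have [S2e|S2n] := eqVneq S2 0%R.
    rewrite S2e mule0; apply: (le_trans (bound 0%R (lexx _) _)).
      move=> f g bf bg [n fE]; rewrite !mul0r.
      apply: (le_trans (inner_cauchy_schwarz pm (bounded_centered pm bf) bg)).
      suff -> : inner pm (centered pm f) (centered pm f) = 0%R by rewrite mul0r.
      apply/eqP; rewrite eq_le inner_ge0 andbT inner_centered// lerBlDr add0r.
      apply: (le_trans _ (sqr_ge0 _)); rewrite -S2e -pmS2; apply: le_Rintegral => //.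
        by apply: bounded_integrable; exact: bounded_measurableM.
      move=> z _; rewrite fE -!expr2 -[leLHS]real_normK ?num_real//.
      by rewrite -[leRHS]real_normK ?num_real// lerXn2r ?nnegrE//; exact: trunc_norm_le.
    (* With [K = 0] the bound is m^2; nonnegativity of the variance [S2 - m ^+ 2] with [S2 = 0]
       forces m = 0. *)
    rewrite lee_fin; have := variance_ge0 pm (h \o fst).
    have -> : 'V_pm[h \o fst] = (S2 - m ^+ 2)%:E.
      rewrite varianceE// unlock EFinB EFin_expe; congr (_ - _ ^+ 2).
        by rewrite -S2E -normE; exact: eq_integral.
      rewrite /m /Rintegral fineK//; apply: integrable_fin_num => //.
      by apply/Lfun1_integrable; apply: Lfun_subset12 hfL2; exact: fin_num_measure.
    by rewrite lee_fin S2e; lra.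
  have S2p : (0 < S2)%R by rewrite lt_neqAle eq_sym S2n.
  rewrite einvE gt0_muley ?lte_fin// gt0_mulye ?lte_fin ?invr_gt0//.
  by rewrite addye// gt0_mulye ?lte_fin// leey.
- by have := R_S_ge0 mW W_ge0 qw; rewrite RSE.
Qed.
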